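(* Let $(V,\mu,R)$ be a braided algebra over a unital commutative ring $\mathbb{k}$, let $n\ge 1$, and let $\mu_n=\sum_{i=0}^n\hbar^i\psi_i$, $R_n=\sum_{i=0}^n\hbar^i\phi_i$ (with $\psi_0=\mu$, $\phi_0=R$, $\psi_i\in\mathrm{Hom}(V^{\otimes 2},V)$, $\phi_i\in\mathrm{Hom}(V^{\otimes 2},V^{\otimes 2})$) define a deformation of degree $n$ of $(V,\mu,R)$. Let $\psi_{n+1}\in\mathrm{Hom}(V^{\otimes 2},V)$, $\phi_{n+1}\in\mathrm{Hom}(V^{\otimes 2},V^{\otimes 2})$, and put $\mu_{n+1}=\mu_n+\hbar^{n+1}\psi_{n+1}$, $R_{n+1}=R_n+\hbar^{n+1}\phi_{n+1}$. Then $(V\otimes\mathbb{k}[[\hbar]]/(\hbar^{n+2}),\mu_{n+1},R_{n+1})$ is a deformation of $(V,\mu,R)$ of order $n+1$ if and only if $$\begin{cases}\delta^2_{\rm YB}(\phi_{n+1})+\Theta_{n+1}=0,\\ \delta^2_{\rm YI}(\phi_{n+1}\oplus\psi_{n+1})+\Xi^{\rm YI}_{n+1}-\Omega^{\rm YI}_{n+1}=0,\\ \delta^2_{\rm IY}(\phi_{n+1}\oplus\psi_{n+1})+\Xi^{\rm IY}_{n+1}-\Omega^{\rm IY}_{n+1}=0,\\ \delta^2_{\rm H}(\psi_{n+1})+\Lambda_{n+1}=0.\end{cases}$$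
   Context: $\otimes=\otimes_{\mathbb{k}}$, $\mathrm{Hom}=\mathrm{Hom}_{\mathbb{k}}$, and $1$ denotes the identity map of $V$. A Yang-Baxter (YB) operator on a $\mathbb{k}$-module $V$ is an invertible map $R:V\otimes V\to V\otimes V$ with $(R\otimes 1)(1\otimes R)(R\otimes 1)=(1\otimes R)(R\otimes 1)(1\otimes R)$. A braided algebra $(V,\mu,R)$ is an associative $\mathbb{k}$-algebra $(V,\mu)$ with a YB operator $R$ on $V$ satisfying (YI) $(1\otimes\mu)(R\otimes 1)(1\otimes R)=R(\mu\otimes 1)$ and (IY) $(\mu\otimes 1)(1\otimes R)(R\otimes 1)=R(1\otimes\mu)$. The same definition applies over other commutative rings. Deformations: a deformation of degree (order) $1$ of $(V,\mu,R)$ is a braided algebra structure $(\mu+\hbar\psi_1,R+\hbar\phi_1)$ over $\mathbb{k}[[\hbar]]/(\hbar^2)$ on $V\otimes\mathbb{k}[[\hbar]]/(\hbar^2)$. Given a deformation $(\tilde V,\tilde\mu,\tilde R)$ of degree $n$, a deformation of order $n+1$ (extending it) is a braided algebra $(\hat V,\hat\mu,\hat R)$ over $\mathbb{k}[[\hbar]]/(\hbar^{n+2})$, $\hat V=V\otimes\mathbb{k}[[\hbar]]/(\hbar^{n+2})$, with $\hat\mu\equiv\tilde\mu$ and $\hat R\equiv\tilde R$ modulo $\hbar^{n+1}$. For $r\ge 2$ let $\Gamma_r=\{(i,j,k): i+j+k=r,\ i,j,k\ge 0,\ i,j,k\ne r\}$, and $\Theta_r=\sum_{(i,j,k)\in\Gamma_r}\bigl[(\phi_i\otimes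 1)(1\otimes\phi_j)(\phi_k\otimes 1)-(1\otimes\phi_i)(\phi_j\otimes 1)(1\otimes\phi_k)\bigr]$; $\Xi^{\rm YI}_r=\sum_{(i,j,k)\in\Gamma_r}(1\otimes\psi_i)(\phi_j\otimes 1)(1\otimes\phi_k)$, $\ \Omega^{\rm YI}_r=\sum_{(p,q,0)\in\Gamma_r}\phi_p(\psi_q\otimes 1)$; $\Xi^{\rm IY}_r=\sum_{(i,j,k)\in\Gamma_r}(\psi_i\otimes 1)(1\otimes\phi_j)(\phi_k\otimes 1)$, $\ \Omega^{\rm IY}_r=\sum_{(p,q,0)\in\Gamma_r}\phi_p(1\otimes\psi_q)$; $\Lambda_r=\sum_{(p,q,0)\in\Gamma_r}\bigl[\psi_p(\psi_q\otimes 1)-\psi_p(1\otimes\psi_q)\bigr]$. Differentials (with $\mu,R$ undeformed): $\delta^2_{\rm YB}(\phi)=(R\otimes 1)(1\otimes R)(\phi\otimes 1)+(R\otimes 1)(1\otimes\phi)(R\otimes 1)+(\phi\otimes 1)(1\otimes R)(R\otimes 1)-(1\otimes R)(R\otimes 1)(1\otimes\phi)-(1\otimes R)(\phi\otimes 1)(1\otimes R)-(1\otimes\phi)(R\otimes 1)(1\otimes R)$; $\delta^2_{\rm H}(\psi)=\mu(\psi\otimes 1)+\psi(\mu\otimes 1)-\mu(1\otimes\psi)-\psi(1\otimes\mu)$; $\delta^2_{\rm YI}(\phi\oplus\psi)=(1\otimes\psi)(R\otimes 1)(1\otimes R)+(1\otimes\mu)(\phi\otimes 1)(1\otimes R)+(1\otimes\mu)(R\otimes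 1)(1\otimes\phi)-R(\psi\otimes 1)-\phi(\mu\otimes 1)$; $\delta^2_{\rm IY}(\phi\oplus\psi)=(\psi\otimes 1)(1\otimes R)(R\otimes 1)+(\mu\otimes 1)(1\otimes\phi)(R\otimes 1)+(\mu\otimes 1)(1\otimes R)(\phi\otimes 1)-R(1\otimes\psi)-\phi(1\otimes\mu)$. *)

(* Defs.v *)
(* boolp is used only to turn the relation defining tensor products into a
   boolean one, so that the quotient type exists. *)
From HB Require Import structures.
From mathcomp Require Import all_boot all_algebra.
From mathcomp Require Import boolp.

Set Implicit Arguments.
Unset Strict Implicit.
Unset Printing Implicit Defensive.

Import GRing.Theory.
Local Open Scope ring_scope.
Local Open Scope quotient_scope.

Reserved Notation "A \ox B" (at level 40, left associativity).
Reserved Notation "x \ot y" (at level 40, left associativity).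

(* A formal sum of pure tensors is a sequence of pairs.  Negatives and scalars
   need no separate syntax, since a (x, y) is represented by (a x, y). *)
Inductive tens_eq (K : comPzRingType) (A B : lmodType K) :
    seq (A * B) -> seq (A * B) -> Prop :=
| tens_eq_refl s : tens_eq s s
| tens_eq_sym s t : tens_eq s t -> tens_eq t s
| tens_eq_trans s t u : tens_eq s t -> tens_eq t u -> tens_eq s u
| tens_eq_cat s s' t t' :
    tens_eq s s' -> tens_eq t t' -> tens_eq (s ++ t) (s' ++ t')
| tens_eq_comm s t : tens_eq (s ++ t) (t ++ s)
| tens_eq_0 y : tens_eq [:: (0, y)] [::]
| tens_eq_Dl x x' y : tens_eq [:: (x + x', y)] [:: (x, y); (x', y)]
| tens_eq_Dr x y y' : tens_eq [:: (x, y + y')] [:: (x, y); (x, y')]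
| tens_eq_Z a x y : tens_eq [:: (a *: x, y)] [:: (x, a *: y)].

Section TensorProduct.
Variables (K : comPzRingType) (A B : lmodType K).

Definition tens_rel : rel (seq (A * B)) := fun s t => `[< tens_eq s t >].

Fact tens_rel_refl : reflexive tens_rel.
Proof. by move=> s; apply/asboolP; constructor. Qed.

Fact tens_rel_sym : symmetric tens_rel.
Proof. by move=> s t; apply: asbool_equiv_eq; split=> /tens_eq_sym. Qed.

Fact tens_rel_trans : transitive tens_rel.
Proof.
move=> t s u /asboolP st /asboolP tu.
by apply/asboolP; apply: tens_eq_trans tu.
Qed.

Canonical tens_equiv_rel :=
  EquivRel tens_rel tens_rel_refl tens_rel_sym tens_rel_trans.

Definition tens := {eq_quot tens_equiv_rel}.
HB.instance Definition _ := Choice.on tens.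

Definition tens_pi (s : seq (A * B)) : tens := \pi_{eq_quot tens_equiv_rel} s.
Definition tens_repr (t : tens) : seq (A * B) := repr t.

Lemma tens_piE s t : tens_eq s t <-> tens_pi s = tens_pi t.
Proof.
rewrite /tens_pi; split=> [st|/eqP].
  by apply/eqP; rewrite eqmodE; apply/asboolP.
by rewrite eqmodE => /asboolP.
Qed.

Lemma tens_reprK t : tens_pi (tens_repr t) = t.
Proof. exact: reprK. Qed.

Lemma tens_repr_pi s : tens_eq (tens_repr (tens_pi s)) s.
Proof. by apply/tens_piE; rewrite tens_reprK. Qed.

Definition pure (x : A) (y : B) : tens := tens_pi [:: (x, y)].

Definition tens_scale_seq (a : K) (s : seq (A * B)) :=
  [seq (a *: p.1, p.2) | p <- s].

Lemma tens_scale_seq_eq a s t :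
  tens_eq s t -> tens_eq (tens_scale_seq a s) (tens_scale_seq a t).
Proof.
elim=> {s t} [s|s t _|s t u _ st _|s s' t t' _ ss' _ tt'|s t|y|x x' y|x y y'|b x y].
- exact: tens_eq_refl.
- exact: tens_eq_sym.
- exact: tens_eq_trans.
- by rewrite /tens_scale_seq !map_cat; apply: tens_eq_cat.
- by rewrite /tens_scale_seq !map_cat; apply: tens_eq_comm.
- by rewrite /tens_scale_seq /= scaler0; apply: tens_eq_0.
- by rewrite /tens_scale_seq /= scalerDr; apply: tens_eq_Dl.
- exact: tens_eq_Dr.
- rewrite /tens_scale_seq /= scalerA mulrC -scalerA; exact: tens_eq_Z.
Qed.

Definition tens_zero : tens := tens_pi [::].
Definition tens_add (s t : tens) : tens := tens_pi (tens_repr s ++ tens_repr t).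
Definition tens_scale (a : K) (t : tens) : tens :=
  tens_pi (tens_scale_seq a (tens_repr t)).
Definition tens_opp (t : tens) : tens := tens_scale (- 1) t.

Lemma tens_addE s t : tens_add (tens_pi s) (tens_pi t) = tens_pi (s ++ t).
Proof. by apply/tens_piE/tens_eq_cat; apply: tens_repr_pi. Qed.

Lemma tens_scaleE a s : tens_scale a (tens_pi s) = tens_pi (tens_scale_seq a s).
Proof. by apply/tens_piE/tens_scale_seq_eq/tens_repr_pi. Qed.

Fact tens_addA : associative tens_add.
Proof.
move=> x y z; rewrite -[x]tens_reprK -[y]tens_reprK -[z]tens_reprK.
by rewrite !tens_addE catA.
Qed.

Fact tens_addC : commutative tens_add.
Proof. by move=> x y; apply/tens_piE/tens_eq_comm. Qed.

Fact tens_add0 : left_id tens_zero tens_add.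
Proof. by move=> x; rewrite -[x]tens_reprK tens_addE. Qed.

Fact tens_scaleDr : right_distributive tens_scale tens_add.
Proof.
move=> a x y; rewrite -[x]tens_reprK -[y]tens_reprK.
by rewrite !(tens_addE, tens_scaleE) /tens_scale_seq map_cat.
Qed.

Fact tens_scaleDl t a b :
  tens_scale (a + b) t = tens_add (tens_scale a t) (tens_scale b t).
Proof.
rewrite -[t]tens_reprK !tens_scaleE tens_addE; apply/tens_piE.
elim: (tens_repr t) => [|[x y] s IH]; first exact: tens_eq_refl.
rewrite /tens_scale_seq /= scalerDl -cat1s.
apply: tens_eq_trans (tens_eq_cat (tens_eq_Dl _ _ _) IH) _.
rewrite -[_ :: _ ++ _]cat1s -cat1s -catA.
apply: (tens_eq_cat (tens_eq_refl [:: (a *: x, y)])).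
rewrite -[(b *: x, y) :: tens_scale_seq b s]cat1s !catA.
exact: tens_eq_cat (tens_eq_comm _ _) (tens_eq_refl _).
Qed.

Fact tens_scale0 t : tens_scale 0 t = tens_zero.
Proof.
rewrite -[t]tens_reprK tens_scaleE; apply/tens_piE.
elim: (tens_repr t) => [|[x y] s IH]; first exact: tens_eq_refl.
rewrite /tens_scale_seq /= scale0r -cat1s.
exact: tens_eq_cat (tens_eq_0 A y) IH.
Qed.

Fact tens_scale1 : left_id 1 tens_scale.
Proof.
move=> t; rewrite -[t]tens_reprK tens_scaleE; congr tens_pi.
by rewrite /tens_scale_seq -[RHS]map_id; apply: eq_map => -[x y] /=; rewrite scale1r.
Qed.

Fact tens_scaleA a b t : tens_scale a (tens_scale b t) = tens_scale (a * b) t.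
Proof.
rewrite -[t]tens_reprK !tens_scaleE; congr tens_pi.
by rewrite /tens_scale_seq -map_comp; apply: eq_map => -[x y] /=; rewrite scalerA.
Qed.

Fact tens_addN : left_inverse tens_zero tens_opp tens_add.
Proof.
by move=> x; rewrite -{2}[x]tens_scale1 -tens_scaleDl addNr tens_scale0.
Qed.

HB.instance Definition _ :=
  GRing.isZmodule.Build tens tens_addA tens_addC tens_add0 tens_addN.
HB.instance Definition _ :=
  GRing.Zmodule_isLmodule.Build K tens tens_scaleA tens_scale1
    tens_scaleDr tens_scaleDl.

End TensorProduct.

Arguments tens {K} (A B)%_type_scope.
Notation "A \ox B" := (tens A B).
Notation "x \ot y" := (pure x y).

Section TensorTheory.
Variables (K : comPzRingType) (A B : lmodType K).

Lemma pureDl (x x' : A) (y : B) : (x + x') \ot y = x \ot y + x' \ot y.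
Proof.
by rewrite /GRing.add /= tens_addE; apply/tens_piE/tens_eq_Dl.
Qed.

Lemma pureDr (x : A) (y y' : B) : x \ot (y + y') = x \ot y + x \ot y'.
Proof.
by rewrite [in RHS]/GRing.add /= tens_addE; apply/tens_piE/tens_eq_Dr.
Qed.

Lemma pureZl a (x : A) (y : B) : (a *: x) \ot y = a *: (x \ot y).
Proof. by rewrite [in RHS]/GRing.scale /= tens_scaleE. Qed.

Lemma pureZr a (x : A) (y : B) : x \ot (a *: y) = a *: (x \ot y).
Proof. by rewrite -pureZl; apply/esym/tens_piE/tens_eq_Z. Qed.

Lemma tens_piS (s : seq (A * B)) : tens_pi s = \sum_(p <- s) p.1 \ot p.2.
Proof.
elim: s => [|[x y] s IH]; first by rewrite big_nil.
by rewrite big_cons -IH /GRing.add /= tens_addE.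
Qed.

Lemma tens_ind (P : A \ox B -> Prop) :
  P 0 -> (forall x y t, P t -> P (x \ot y + t)) -> forall t, P t.
Proof.
move=> P0 PD t; rewrite -[t]tens_reprK tens_piS.
by elim: (tens_repr t) => [|p s IH]; rewrite ?big_nil // big_cons; apply: PD.
Qed.

(* The additive map out of A \ox B induced by f; meaningful when f is
   biadditive and K-balanced (see tens_lift_pure). *)
Definition tens_lift (Z : zmodType) (f : A -> B -> Z) (t : A \ox B) : Z :=
  \sum_(p <- tens_repr t) f p.1 p.2.

Definition balanced (Z : zmodType) (f : A -> B -> Z) : Prop :=
  [/\ forall x x' y, f (x + x') y = f x y + f x' y,
      forall x y y', f x (y + y') = f x y + f x y'
    & forall a x y, f (a *: x) y = f x (a *: y)].

Lemma tens_lift_pi (Z : zmodType) (f : A -> B -> Z) s :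
  balanced f -> tens_lift f (tens_pi s) = \sum_(p <- s) f p.1 p.2.
Proof.
case=> fDl fDr fZ; rewrite /tens_lift.
have: tens_eq (tens_repr (tens_pi s)) s by exact: tens_repr_pi.
move: (tens_repr _) => r; elim=> {r s} [s|s t _ ->|s t u _ -> _ ->|s s' t t' _ ss' _ tt'
  |s t|y|x x' y|x y y'|a x y] //.
- by rewrite !big_cat /= ss' tt'.
- by rewrite !big_cat /= addrC.
- by rewrite big_seq1 big_nil /=; apply: (addrI (f 0 y)); rewrite -fDl !addr0.
- by rewrite !big_cons !big_nil /= !addr0 fDl.
- by rewrite !big_cons !big_nil /= !addr0 fDr.
- by rewrite !big_seq1 /= fZ.
Qed.

Lemma tens_lift_pure (Z : zmodType) (f : A -> B -> Z) x y :
  balanced f -> tens_lift f (x \ot y) = f x y.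
Proof. by move=> bf; rewrite tens_lift_pi // big_seq1. Qed.

Lemma tens_liftD (Z : zmodType) (f : A -> B -> Z) s t :
  balanced f -> tens_lift f (s + t) = tens_lift f s + tens_lift f t.
Proof.
move=> bf; rewrite -[s]tens_reprK -[t]tens_reprK {1}/GRing.add /= tens_addE.
by rewrite !tens_lift_pi // big_cat.
Qed.

Definition bilinear_fun (C : lmodType K) (f : A -> B -> C) : Prop :=
  (forall y, linear (f^~ y)) /\ (forall x, linear (f x)).

Lemma bilinear_balanced (C : lmodType K) (f : A -> B -> C) :
  bilinear_fun f -> balanced f.
Proof.
case=> fl fr; split=> [x x' y|x y y'|a x y].
- by have := fl y 1 x x'; rewrite !scale1r.
- by have := fr x 1 y y'; rewrite !scale1r.
have f0l : f 0 y = 0.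
  by have := fl y (-1) 0 0; rewrite scaler0 addr0 scaleN1r addNr.
have f0r : f x 0 = 0.
  by have := fr x (-1) 0 0; rewrite scaler0 addr0 scaleN1r addNr.
have := fl y a x 0; have := fr x a y 0.
by rewrite !addr0 f0l f0r !addr0 => -> ->.
Qed.

Lemma tens_lift_linear (C : lmodType K) (f : A -> B -> C) :
  bilinear_fun f -> linear (tens_lift f).
Proof.
move=> bf; have bal := bilinear_balanced bf; case: bf => fl fr a s t.
rewrite tens_liftD //; congr (_ + _).
rewrite -[s]tens_reprK {1}/GRing.scale /= tens_scaleE !tens_lift_pi //.
rewrite scaler_sumr /tens_scale_seq big_map; apply: eq_bigr => -[x y] _ /=.
have f0 : f 0 y = 0.
  by have := fl y (-1) 0 0; rewrite scaler0 addr0 scaleN1r addNr.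
by have := fl y a x 0; rewrite f0 !addr0.
Qed.

Lemma pure_bilinear : bilinear_fun (@pure K A B).
Proof.
by split=> [y|x] a u v; rewrite ?pureDl ?pureZl ?pureDr ?pureZr.
Qed.

End TensorTheory.

Section TensorMap.
Variables (K : comPzRingType) (A A' B B' : lmodType K).
Variables (f : {linear A -> A'}) (g : {linear B -> B'}).

Definition tmap : A \ox B -> A' \ox B' := tens_lift (fun x y => f x \ot g y).

Lemma tmap_bilinear : bilinear_fun (fun x y => f x \ot g y).
Proof.
by split=> [y|x] a u v; rewrite linearP ?pureDl ?pureZl ?pureDr ?pureZr.
Qed.

Lemma tmap_pure x y : tmap (x \ot y) = f x \ot g y.
Proof. exact/tens_lift_pure/bilinear_balanced/tmap_bilinear. Qed.

HB.instance Definition _ :=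
  GRing.isLinear.Build K _ _ _ tmap
    (tens_lift_linear tmap_bilinear).

End TensorMap.

Section Associator.
Variables (K : comPzRingType) (A B C : lmodType K).

Definition tassoc : (A \ox B) \ox C -> A \ox (B \ox C) :=
  tens_lift (fun p z => tens_lift (fun x y => x \ot (y \ot z)) p).

Definition tassocV : A \ox (B \ox C) -> (A \ox B) \ox C :=
  tens_lift (fun x q => tens_lift (fun y z => (x \ot y) \ot z) q).

Fact tassoc_inner z : bilinear_fun (fun (x : A) (y : B) => x \ot (y \ot z : B \ox C)).
Proof.
by split=> [y|x] a u v; rewrite ?pureDl ?pureZl ?pureDr ?pureZr.
Qed.

Fact tassocV_inner x : bilinear_fun (fun (y : B) (z : C) => (x \ot y : A \ox B) \ot z).
Proof.
by split=> [y|z] a u v; rewrite ?(pureDl, pureZl, pureDr, pureZr).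
Qed.

Fact tassoc_bilinear : bilinear_fun
  (fun p z => tens_lift (fun (x : A) (y : B) => x \ot (y \ot z : B \ox C)) p).
Proof.
split=> [z|p a z z']; first exact: tens_lift_linear (tassoc_inner z).
rewrite /tens_lift scaler_sumr -big_split /=; apply: eq_bigr => q _.
by rewrite !pureDr !pureZr.
Qed.

Fact tassocV_bilinear : bilinear_fun
  (fun x q => tens_lift (fun (y : B) (z : C) => (x \ot y : A \ox B) \ot z) q).
Proof.
split=> [q a x x'|x]; last exact: tens_lift_linear (tassocV_inner x).
rewrite /tens_lift scaler_sumr -big_split /=; apply: eq_bigr => p _.
by rewrite !pureDl !pureZl.
Qed.

HB.instance Definition _ := GRing.isLinear.Build K _ _ _ tassoc
  (tens_lift_linear tassoc_bilinear).
HB.instance Definition _ := GRing.isLinear.Build K _ _ _ tassocV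
  (tens_lift_linear tassocV_bilinear).

Lemma tassoc_pure x y z : tassoc ((x \ot y) \ot z) = x \ot (y \ot z).
Proof.
rewrite /tassoc tens_lift_pure; last exact/bilinear_balanced/tassoc_bilinear.
by rewrite tens_lift_pure //; apply/bilinear_balanced/tassoc_inner.
Qed.

Lemma tassocV_pure x y z : tassocV (x \ot (y \ot z)) = (x \ot y) \ot z.
Proof.
rewrite /tassocV tens_lift_pure; last exact/bilinear_balanced/tassocV_bilinear.
by rewrite tens_lift_pure //; apply/bilinear_balanced/tassocV_inner.
Qed.

End Associator.

Section BraidedAlgebra.
Variables (K : comPzRingType) (V : lmodType K).

Definition mult_op := {linear V \ox V -> V}.
Definition braid_op := {linear V \ox V -> V \ox V}.

(* V^{(x)3} is bracketed to the left, so an operator acting on the last two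
   factors is conjugated by the associator.  Here lbraid f = f (x) 1,
   rbraid f = 1 (x) f, lmult m = m (x) 1 and rmult m = 1 (x) m. *)
Definition lbraid (f : braid_op) : {linear V \ox V \ox V -> V \ox V \ox V} :=
  tmap f idfun.
Definition rbraid (f : braid_op) : {linear V \ox V \ox V -> V \ox V \ox V} :=
  @tassocV K V V V \o tmap idfun f \o @tassoc K V V V.
Definition lmult (m : mult_op) : {linear V \ox V \ox V -> V \ox V} :=
  tmap m idfun.
Definition rmult (m : mult_op) : {linear V \ox V \ox V -> V \ox V} :=
  tmap idfun m \o @tassoc K V V V.

Definition yang_baxter (R : braid_op) : Prop :=
  bijective R /\
  forall x, lbraid R (rbraid R (lbraid R x)) = rbraid R (lbraid R (rbraid R x)).

Record braided_algebra (mu : mult_op) (R : braid_op) : Prop := {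
  braided_assoc : forall x, mu (lmult mu x) = mu (rmult mu x);
  braided_YB : yang_baxter R;
  braided_YI : forall x, rmult mu (lbraid R (rbraid R x)) = R (lmult mu x);
  braided_IY : forall x, lmult mu (rbraid R (lbraid R x)) = R (rmult mu x)
}.

End BraidedAlgebra.

Arguments mult_op {K} V%_type_scope.
Arguments braid_op {K} V%_type_scope.

(* k[[h]]/(h^m), as coefficient sequences of length m with the truncated
   convolution product. *)
Definition tseries (k : comPzRingType) (m : nat) : Type := {ffun 'I_m -> k}.

Section TruncatedSeries.
Variables (k : comPzRingType) (m : nat).

HB.instance Definition _ := GRing.Lmodule.copy (tseries k m) {ffun 'I_m -> k^o}.

Implicit Types f g : tseries k m.

Definition tseries_one : tseries k m := [ffun i : 'I_m => (i == 0 :> nat)%:R].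
Definition tseries_mul f g : tseries k m :=
  [ffun i : 'I_m => \sum_(a < m) \sum_(b < m | (a + b == i)%N) f a * g b].

Fact tseries_mulC : commutative tseries_mul.
Proof.
move=> f g; apply/ffunP=> i; rewrite !ffunE.
rewrite (exchange_big_dep predT) //=; apply: eq_bigr => b _.
by apply: eq_big => a; rewrite ?(addnC b) // => _; rewrite mulrC.
Qed.

Fact tseries_mul1 : left_id tseries_one tseries_mul.
Proof.
move=> f; apply/ffunP=> i; rewrite !ffunE.
have m_gt0 : (0 < m)%N by apply: leq_ltn_trans (ltn_ord i).
rewrite (bigD1 (Ordinal m_gt0)) //= [X in _ + X]big1 ?addr0.
  rewrite (eq_bigl (pred1 i)) ?big_pred1_eq ?ffunE ?mul1r //.
move=> a a0; apply: big1 => b _; rewrite ffunE.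
have -> : (a == 0 :> nat) = false by apply/negbTE.
by rewrite mul0r.
Qed.

Fact tseries_mulDl : left_distributive tseries_mul +%R.
Proof.
move=> f g h; apply/ffunP=> i; rewrite !ffunE -big_split /=.
apply: eq_bigr => a _; rewrite -big_split /=; apply: eq_bigr => b _.
by rewrite !ffunE mulrDl.
Qed.

Lemma tseries_sum3 f g h (i : 'I_m) :
  tseries_mul f (tseries_mul g h) i =
  \sum_(a < m) \sum_(b < m) \sum_(c < m | (a + b + c == i)%N)
     f a * (g b * h c).
Proof.
rewrite ffunE; apply: eq_bigr => a _.
under eq_bigr => d _ do rewrite ffunE mulr_sumr.
rewrite exchange_big /=; apply: eq_bigr => b _.
under eq_bigr => d _ do rewrite mulr_sumr.
rewrite (exchange_big_dep predT) //=.
rewrite [RHS]big_mkcond /=; apply: eq_bigr => c _.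
case: ifP => [/eqP abc|abc].
  have ltd : (b + c < m)%N.
    by apply: leq_ltn_trans (ltn_ord i); rewrite -abc -addnA leq_addl.
  rewrite (big_pred1 (Ordinal ltd)) // => d; rewrite /= -val_eqE /= [RHS]eq_sym.
  by case: (_ =P nat_of_ord d) => [<-|]; rewrite ?andbF // addnA abc eqxx.
apply: big_pred0 => d; apply/negP=> /andP[/eqP ad /eqP bc].
by move: abc; rewrite -addnA bc ad eqxx.
Qed.

Fact tseries_mulA : associative tseries_mul.
Proof.
move=> f g h; apply/ffunP=> i.
rewrite [RHS](congr1 (fun u => (u : {ffun 'I_m -> k}) i) (tseries_mulC _ _)) !tseries_sum3.
rewrite [RHS]exchange_big /=; apply: eq_bigr => a _.
under [RHS]eq_bigr => c _ do rewrite big_mkcond.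
rewrite [RHS]exchange_big /=; apply: eq_bigr => b _.
rewrite [LHS]big_mkcond; apply: eq_bigr => c _.
by rewrite [(c + a)%N]addnC addnAC; case: ifP => // _; rewrite [RHS]mulrC mulrA.
Qed.

HB.instance Definition _ := GRing.Zmodule_isComPzRing.Build (tseries k m)
  tseries_mulA tseries_mulC tseries_mul1 tseries_mulDl.

Lemma tseries_scaleAl (a : k) f g : a *: (f * g) = (a *: f) * g.
Proof.
apply/ffunP=> i; rewrite !ffunE scaler_sumr; apply: eq_bigr => b _.
by rewrite scaler_sumr; apply: eq_bigr => c _; rewrite !ffunE; apply: mulrA.
Qed.

Definition hbar : tseries k m := [ffun i : 'I_m => (i == 1 :> nat)%:R].

End TruncatedSeries.

Section BaseChange.
Variables (k : comPzRingType) (m : nat).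
Let K : comPzRingType := tseries k m.

(* A (x)_k k[[h]]/(h^m), with its k[[h]]/(h^m)-module structure. *)
Definition bc (A : lmodType k) : Type := A \ox tseries k m.

Definition bc_pure (A : lmodType k) (x : A) (c : tseries k m) : bc A := x \ot c.

Section Scale.
Variable A : lmodType k.

HB.instance Definition _ := GRing.Zmodule.copy (bc A) (A \ox tseries k m).

Definition bc_scale (c : K) : bc A -> bc A :=
  tens_lift (fun (x : A) (d : tseries k m) => x \ot (c * d : tseries k m)).

Fact bc_scale_bilinear (c : K) :
  bilinear_fun (fun (x : A) (d : tseries k m) => x \ot (c * d : tseries k m)).
Proof.
split=> [d|x] a u v; first by rewrite pureDl pureZl.
by rewrite mulrDr [c * _]mulrC -tseries_scaleAl pureDr pureZr [u * _]mulrC.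
Qed.

Lemma bc_scale_pure (c : K) x d : bc_scale c (bc_pure x d) = bc_pure x (c * d).
Proof. exact/tens_lift_pure/bilinear_balanced/bc_scale_bilinear. Qed.

Fact bc_scaleDr : right_distributive bc_scale +%R.
Proof.
by move=> c s t; apply/tens_liftD/bilinear_balanced/bc_scale_bilinear.
Qed.

Lemma bc_ind (P : bc A -> Prop) :
  P 0 -> (forall x c t, P t -> P (bc_pure x c + t)) -> forall t, P t.
Proof. exact: tens_ind. Qed.

Fact bc_scaler0 c : bc_scale c 0 = 0.
Proof. by apply: (addrI (bc_scale c 0)); rewrite -bc_scaleDr !addr0. Qed.

Fact bc_scaleA a b v : bc_scale a (bc_scale b v) = bc_scale (a * b) v.
Proof.
elim/bc_ind: v => [|x c t IH]; first by rewrite !bc_scaler0.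
by rewrite !bc_scaleDr !bc_scale_pure IH mulrA.
Qed.

Fact bc_scale1 : left_id 1 bc_scale.
Proof.
elim/bc_ind=> [|x c t IH]; first by rewrite bc_scaler0.
by rewrite bc_scaleDr bc_scale_pure IH mul1r.
Qed.

Fact bc_scaleDl v : {morph bc_scale^~ v : a b / a + b}.
Proof.
move=> a b; elim/bc_ind: v => [|x c t IH]; first by rewrite !bc_scaler0 addr0.
rewrite !bc_scaleDr !bc_scale_pure IH mulrDl /bc_pure pureDr.
exact: addrACA.
Qed.

HB.instance Definition _ := GRing.Zmodule_isLmodule.Build (tseries k m) (bc A)
  bc_scaleA bc_scale1 bc_scaleDr bc_scaleDl.

Lemma bc_pureZ (c : K) x d : bc_pure x (c * d) = c *: (bc_pure x d).
Proof. by rewrite -bc_scale_pure. Qed.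

Lemma bc_pureD x c d : bc_pure x (c + d) = bc_pure x c + bc_pure x d.
Proof. exact: pureDr. Qed.

End Scale.

Section Map.
Variables (A B : lmodType k) (f : {linear A -> B}).

(* f (x) 1 : A (x) k[[h]]/(h^m) -> B (x) k[[h]]/(h^m) *)
Definition bc_map : bc A -> bc B := tmap f idfun.

Lemma bc_map_pure x c : bc_map (bc_pure x c) = bc_pure (f x) c.
Proof. exact: tmap_pure. Qed.

Fact bc_map_linear : linear bc_map.
Proof.
have mD : forall s t, bc_map (s + t) = bc_map s + bc_map t.
  exact: (raddfD (tmap f idfun)).
have m0 : bc_map 0 = 0 by exact: (raddf0 (tmap f idfun)).
move=> c s t; rewrite mD; congr (_ + _).
elim/bc_ind: s => [|x d s IH]; first by rewrite scaler0 m0 scaler0.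
by rewrite scalerDr !mD IH -bc_pureZ !bc_map_pure bc_pureZ scalerDr.
Qed.

HB.instance Definition _ := GRing.isLinear.Build (tseries k m) (bc A) (bc B) _
  bc_map bc_map_linear.

End Map.

Section Tensor.
Variables A B : lmodType k.

(* The isomorphism
     (A (x) K) (x)_K (B (x) K) = (A (x) B) (x) K,  K = k[[h]]/(h^m),
   and its inverse. *)
Definition bc_tens_gen (x : A) (c : tseries k m) (y : B) (d : tseries k m) :
    A \ox B \ox tseries k m :=
  (x \ot y) \ot (c * d : tseries k m).

Definition bc_tens_fun (s : bc A) (t : bc B) : bc (A \ox B) :=
  tens_lift (fun x c => tens_lift (bc_tens_gen x c) t) s.

Definition bc_tens : bc A \ox bc B -> bc (A \ox B) := tens_lift bc_tens_fun.

Definition bc_tensV_fun (p : A \ox B) : bc A \ox bc B :=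
  tens_lift (fun x y => bc_pure x 1 \ot bc_pure y 1) p.

Definition bc_tensV : bc (A \ox B) -> bc A \ox bc B :=
  tens_lift (fun (p : A \ox B) (c : tseries k m) => c *: bc_tensV_fun p).

Fact bc_tens_gen_inner x c : bilinear_fun (bc_tens_gen x c).
Proof.
split=> [d|y] a u v; rewrite /bc_tens_gen.
  by rewrite pureDr pureZr pureDl pureZl.
by rewrite mulrDr [c * _]mulrC -tseries_scaleAl pureDr pureZr [u * _]mulrC.
Qed.

Fact bc_tens_gen_outer (t : bc B) :
  bilinear_fun (fun x c => tens_lift (bc_tens_gen x c) t).
Proof.
split=> [c|x] a u v; rewrite /tens_lift scaler_sumr -big_split /=;
  apply: eq_bigr => p _; rewrite /bc_tens_gen.
  by rewrite pureDl pureZl pureDl pureZl.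
by rewrite mulrDl -tseries_scaleAl pureDr pureZr.
Qed.

Lemma bc_tens_fun_pure x c y d :
  bc_tens_fun (bc_pure x c) (bc_pure y d) = bc_pure (x \ot y) (c * d).
Proof.
rewrite /bc_tens_fun tens_lift_pure.
  exact/tens_lift_pure/bilinear_balanced/bc_tens_gen_inner.
exact/bilinear_balanced/bc_tens_gen_outer.
Qed.

Lemma bc_tens_funDl s s' t :
  bc_tens_fun (s + s') t = bc_tens_fun s t + bc_tens_fun s' t.
Proof. exact/tens_liftD/bilinear_balanced/bc_tens_gen_outer. Qed.

Lemma bc_tens_funDr s t t' :
  bc_tens_fun s (t + t') = bc_tens_fun s t + bc_tens_fun s t'.
Proof.
rewrite /bc_tens_fun {1 3 5}/tens_lift -big_split; apply: eq_bigr => p _.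
exact/tens_liftD/bilinear_balanced/bc_tens_gen_inner.
Qed.

Lemma bc_tens_fun0l t : bc_tens_fun 0 t = 0.
Proof. by apply: (addrI (bc_tens_fun 0 t)); rewrite -bc_tens_funDl !addr0. Qed.

Lemma bc_tens_fun0r s : bc_tens_fun s 0 = 0.
Proof. by apply: (addrI (bc_tens_fun s 0)); rewrite -bc_tens_funDr !addr0. Qed.

Lemma bc_tens_funZl (a : K) s t : bc_tens_fun (a *: s) t = a *: bc_tens_fun s t.
Proof.
elim/bc_ind: s => [|x c s IH]; first by rewrite scaler0 !bc_tens_fun0l scaler0.
rewrite scalerDr !bc_tens_funDl IH scalerDr; congr (_ + _).
elim/bc_ind: t {IH} => [|y d t IH]; first by rewrite !bc_tens_fun0r scaler0.
rewrite !bc_tens_funDr IH scalerDr; congr (_ + _).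
by rewrite -bc_pureZ !bc_tens_fun_pure -bc_pureZ mulrA.
Qed.

Lemma bc_tens_funZr (a : K) s t : bc_tens_fun s (a *: t) = a *: bc_tens_fun s t.
Proof.
elim/bc_ind: t => [|y d t IH]; first by rewrite scaler0 !bc_tens_fun0r scaler0.
rewrite scalerDr !bc_tens_funDr IH scalerDr; congr (_ + _).
elim/bc_ind: s {IH} => [|x c s IH]; first by rewrite !bc_tens_fun0l scaler0.
rewrite !bc_tens_funDl IH scalerDr; congr (_ + _).
by rewrite -bc_pureZ !bc_tens_fun_pure -bc_pureZ mulrCA.
Qed.

Lemma bc_tens_fun_bilinear : bilinear_fun bc_tens_fun.
Proof.
split=> [t|s] a u v; first by rewrite bc_tens_funDl bc_tens_funZl.
by rewrite bc_tens_funDr bc_tens_funZr.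
Qed.

HB.instance Definition _ := GRing.isLinear.Build (tseries k m) _ _ _ bc_tens
  (tens_lift_linear bc_tens_fun_bilinear).

Lemma bc_tens_pure x c y d :
  bc_tens (bc_pure x c \ot bc_pure y d) = bc_pure (x \ot y) (c * d).
Proof.
rewrite /bc_tens tens_lift_pure ?bc_tens_fun_pure //.
exact/bilinear_balanced/bc_tens_fun_bilinear.
Qed.

Lemma bc_pure_scale (C : lmodType k) (a : k) (x : C) c :
  bc_pure (a *: x) c = (a *: (1 : tseries k m)) *: bc_pure x c.
Proof.
by rewrite -bc_pureZ -tseries_scaleAl mul1r /bc_pure pureZl pureZr.
Qed.

Lemma bc_pureDl (C : lmodType k) (x y : C) c :
  bc_pure (x + y) c = bc_pure x c + bc_pure y c.
Proof. exact: pureDl. Qed.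

Fact bc_tensV_gen_balanced :
  balanced (fun (x : A) (y : B) => bc_pure x 1 \ot bc_pure y 1).
Proof.
split=> [x x' y|x y y'|a x y].
- by rewrite bc_pureDl pureDl.
- by rewrite bc_pureDl pureDr.
- by rewrite !bc_pure_scale pureZl pureZr.
Qed.

Lemma bc_tensV_fun_pure x y :
  bc_tensV_fun (x \ot y) = bc_pure x 1 \ot bc_pure y 1.
Proof. exact/tens_lift_pure/bc_tensV_gen_balanced. Qed.

Lemma bc_tensV_funD p q : bc_tensV_fun (p + q) = bc_tensV_fun p + bc_tensV_fun q.
Proof. exact/tens_liftD/bc_tensV_gen_balanced. Qed.

Lemma bc_tensV_fun0 : bc_tensV_fun 0 = 0.
Proof. by apply: (addrI (bc_tensV_fun 0)); rewrite -bc_tensV_funD !addr0. Qed.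

Lemma bc_tensV_funZ (a : k) p :
  bc_tensV_fun (a *: p) = (a *: (1 : tseries k m)) *: bc_tensV_fun p.
Proof.
elim/tens_ind: p => [|x y p IH]; first by rewrite scaler0 bc_tensV_fun0 scaler0.
rewrite scalerDr !bc_tensV_funD IH scalerDr -pureZl !bc_tensV_fun_pure.
by rewrite bc_pure_scale pureZl.
Qed.

Fact bc_tensV_balanced :
  balanced (fun (p : A \ox B) (c : tseries k m) => c *: bc_tensV_fun p).
Proof.
split=> [p q c|p c d|a p c].
- by rewrite bc_tensV_funD scalerDr.
- by rewrite scalerDl.
- by rewrite bc_tensV_funZ scalerA mulrC -tseries_scaleAl mul1r.
Qed.

Lemma bc_tensV_pure p c : bc_tensV (bc_pure p c) = c *: bc_tensV_fun p.
Proof. exact/tens_lift_pure/bc_tensV_balanced. Qed.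

Lemma bc_tensVD s t : bc_tensV (s + t) = bc_tensV s + bc_tensV t.
Proof. exact/tens_liftD/bc_tensV_balanced. Qed.

Fact bc_tensV_linear : linear bc_tensV.
Proof.
move=> a s t; rewrite bc_tensVD; congr (_ + _).
have V0 : bc_tensV 0 = 0.
  by apply: (addrI (bc_tensV 0)); rewrite -bc_tensVD !addr0.
elim/bc_ind: s => [|p c s IH]; first by rewrite scaler0 V0 scaler0.
by rewrite scalerDr !bc_tensVD IH -bc_pureZ !bc_tensV_pure scalerDr scalerA.
Qed.

HB.instance Definition _ := GRing.isLinear.Build (tseries k m) _ _ _ bc_tensV
  bc_tensV_linear.

Lemma bc_tensK : cancel bc_tens bc_tensV.
Proof.
elim/tens_ind=> [|s t u IH]; first by rewrite linear0 /= linear0.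
rewrite linearD /= linearD /= IH; congr (_ + _).
elim/bc_ind: s {IH} => [|x c s IH].
  have -> : (0 : bc A) \ot t = 0 by rewrite -(scale0r (0 : bc A)) pureZl scale0r.
  by rewrite linear0 /= linear0.
rewrite pureDl linearD /= linearD /= IH; congr (_ + _).
elim/bc_ind: t {IH} => [|y d t IH].
  have -> : bc_pure x c \ot (0 : bc B) = 0.
    by rewrite -(scale0r (0 : bc B)) pureZr scale0r.
  by rewrite linear0 /= linear0.
rewrite pureDr linearD /= linearD /= IH; congr (_ + _).
rewrite bc_tens_pure bc_tensV_pure bc_tensV_fun_pure.
by rewrite -scalerA -pureZr -pureZl -!bc_pureZ !mulr1.
Qed.

Lemma bc_tensVK : cancel bc_tensV bc_tens.
Proof.
elim/bc_ind=> [|p c s IH]; first by rewrite linear0 /= linear0.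
rewrite linearD /= linearD /= IH bc_tensV_pure linearZ /=; congr (_ + _).
rewrite -[in RHS](mulr1 c) bc_pureZ; congr (_ *: _).
elim/tens_ind: p {IH} => [|x y p IH].
  by rewrite bc_tensV_fun0 linear0 -(scale0r (0 : A \ox B)) /bc_pure pureZl scale0r.
by rewrite bc_tensV_funD linearD /= IH bc_tensV_fun_pure bc_tens_pure mulr1 bc_pureDl.
Qed.

End Tensor.

Variable V : lmodType k.

(* Extension of scalars of the operations on V. *)
Definition bc_mult (psi : mult_op V) : mult_op (bc V) :=
  bc_map psi \o @bc_tens V V.
Definition bc_braid (phi : braid_op V) : braid_op (bc V) :=
  @bc_tensV V V \o bc_map phi \o @bc_tens V V.

End BaseChange.

(* The truncated power series \sum_(i <= n) a^i f_i of linear maps. *)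
Section LinearSeries.
Variables (K : comPzRingType) (A B : lmodType K).
Variables (a : K) (n : nat) (f : nat -> {linear A -> B}).

Definition lin_series (x : A) : B := \sum_(i < n.+1) a ^+ i *: f i x.

Fact lin_series_linear : linear lin_series.
Proof.
move=> c x y; rewrite /lin_series scaler_sumr -big_split /=.
apply: eq_bigr => i _.
by rewrite linearP scalerDr !scalerA [c * _]mulrC.
Qed.

HB.instance Definition _ := GRing.isLinear.Build K A B _ lin_series
  lin_series_linear.

End LinearSeries.

Section Reduction.
Variables (k : comPzRingType) (m : nat).

(* Reduction modulo h^m, from k[[h]]/(h^(m+1)) to k[[h]]/(h^m). *)
Definition tseries_red (f : tseries k m.+1) : tseries k m :=
  [ffun i : 'I_m => f (widen_ord (leqnSn m) i)].

Fact tseries_red_linear : linear tseries_red.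
Proof. by move=> a f g; apply/ffunP=> i; rewrite !ffunE. Qed.

HB.instance Definition _ := GRing.isLinear.Build k _ _ _ tseries_red
  tseries_red_linear.

Fact tseries_red_is_monoid_morphism : monoid_morphism tseries_red.
Proof.
split=> [|f g]; apply/ffunP=> i; rewrite !ffunE //=.
rewrite big_ord_recr /= [X in _ + X]big1 ?addr0 => [|b /eqP bi]; last first.
  by have := ltn_ord i; rewrite -bi -ltn_subRL subnn.
apply: eq_bigr => a _; rewrite [LHS]big_mkcond big_ord_recr /=.
case: ifP => [/eqP ai|_].
  by have := ltn_ord i; rewrite -ai addnC -ltn_subRL subnn.
by rewrite addr0 -big_mkcond; apply: eq_bigr => b _; rewrite !ffunE.
Qed.

HB.instance Definition _ := GRing.isMonoidMorphism.Build _ _ tseries_red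
  tseries_red_is_monoid_morphism.

Definition bc_red (A : lmodType k) : bc m.+1 A -> bc m A :=
  tmap idfun tseries_red.

(* The map induced by bc_red on tensor squares; the source is a tensor product
   over k[[h]]/(h^(m+1)) and the target one over k[[h]]/(h^m). *)
Definition bc_red2 (A : lmodType k) :
    bc m.+1 A \ox bc m.+1 A -> bc m A \ox bc m A :=
  tens_lift (fun s t => bc_red s \ot bc_red t).

Lemma bc_red_pure (A : lmodType k) (x : A) c :
  bc_red (bc_pure x c) = bc_pure x (tseries_red c).
Proof. exact: tmap_pure. Qed.

Lemma bc_redD (A : lmodType k) (s t : bc m.+1 A) :
  bc_red (s + t) = bc_red s + bc_red t.
Proof. exact: raddfD (tmap idfun tseries_red) s t. Qed.

Lemma bc_redZ (A : lmodType k) (c : tseries k m.+1) (s : bc m.+1 A) :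
  bc_red (c *: s) = tseries_red c *: bc_red s.
Proof.
have r0 : bc_red (0 : bc m.+1 A) = 0 by exact: (raddf0 (tmap idfun tseries_red)).
elim/bc_ind: s => [|x d s IH]; first by rewrite scaler0 r0 scaler0.
by rewrite scalerDr !bc_redD IH -bc_pureZ !bc_red_pure rmorphM bc_pureZ scalerDr.
Qed.

Fact bc_red2_balanced (A : lmodType k) :
  balanced (fun s t : bc m.+1 A => bc_red s \ot bc_red t).
Proof.
split=> [s s' t|s t t'|c s t].
- by rewrite bc_redD pureDl.
- by rewrite bc_redD pureDr.
- by rewrite !bc_redZ pureZl pureZr.
Qed.

Lemma bc_red2_pure (A : lmodType k) (s t : bc m.+1 A) :
  bc_red2 (s \ot t) = bc_red s \ot bc_red t.
Proof. exact/tens_lift_pure/bc_red2_balanced. Qed.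

End Reduction.

Section Deformations.
Variables (k : comPzRingType) (V : lmodType k).

(* \sum_(i <= n) h^i psi_i and \sum_(i <= n) h^i phi_i on V[[h]]/(h^(n+1)),
   the operations of V being extended by scalars. *)
Definition mult_series n (psi : nat -> mult_op V) : mult_op (bc n.+1 V) :=
  lin_series (hbar k n.+1) n (fun i => bc_mult n.+1 (psi i)).
Definition braid_series n (phi : nat -> braid_op V) : braid_op (bc n.+1 V) :=
  lin_series (hbar k n.+1) n (fun i => bc_braid n.+1 (phi i)).

(* Congruence modulo h^(n+1) of operations over k[[h]]/(h^(n+2)) with
   operations over k[[h]]/(h^(n+1)). *)
Definition mult_congr n (muh : mult_op (bc n.+2 V)) (mut : mult_op (bc n.+1 V)) :=
  forall x, bc_red (muh x) = mut (bc_red2 x).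
Definition braid_congr n (Rh : braid_op (bc n.+2 V)) (Rt : braid_op (bc n.+1 V)) :=
  forall x, bc_red2 (Rh x) = Rt (bc_red2 x).

(* Degree 0 is not inhabited: deformation_S only extends deformations of
   degree n >= 1. *)
Inductive is_deformation (mu : mult_op V) (R : braid_op V) :
    forall n, mult_op (bc n.+1 V) -> braid_op (bc n.+1 V) -> Prop :=
| deformation_1 (psi : nat -> mult_op V) (phi : nat -> braid_op V) :
    psi 0 = mu -> phi 0 = R ->
    braided_algebra (mult_series 1 psi) (braid_series 1 phi) ->
    is_deformation mu R (mult_series 1 psi) (braid_series 1 phi)
| deformation_S n (mut : mult_op (bc n.+1 V)) (Rt : braid_op (bc n.+1 V))
    (muh : mult_op (bc n.+2 V)) (Rh : braid_op (bc n.+2 V)) :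
    is_deformation mu R mut Rt ->
    braided_algebra muh Rh -> mult_congr muh mut -> braid_congr Rh Rt ->
    is_deformation mu R muh Rh.

End Deformations.

Section Obstruction.
Variables (k : comPzRingType) (V : lmodType k).

Definition Gamma (r i j l : nat) : bool :=
  [&& (i + j + l == r)%N, i != r, j != r & l != r].

Section Classes.
Variables (psi : nat -> mult_op V) (phi : nat -> braid_op V) (r : nat).
Implicit Type x : V \ox V \ox V.

Definition Theta x : V \ox V \ox V :=
  \sum_(i < r.+1) \sum_(j < r.+1) \sum_(l < r.+1 | Gamma r i j l)
    (lbraid (phi i) (rbraid (phi j) (lbraid (phi l) x))
     - rbraid (phi i) (lbraid (phi j) (rbraid (phi l) x))).

Definition XiYI x : V \ox V :=
  \sum_(i < r.+1) \sum_(j < r.+1) \sum_(l < r.+1 | Gamma r i j l)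
    rmult (psi i) (lbraid (phi j) (rbraid (phi l) x)).

Definition OmegaYI x : V \ox V :=
  \sum_(p < r.+1) \sum_(q < r.+1 | Gamma r p q 0) phi p (lmult (psi q) x).

Definition XiIY x : V \ox V :=
  \sum_(i < r.+1) \sum_(j < r.+1) \sum_(l < r.+1 | Gamma r i j l)
    lmult (psi i) (rbraid (phi j) (lbraid (phi l) x)).

Definition OmegaIY x : V \ox V :=
  \sum_(p < r.+1) \sum_(q < r.+1 | Gamma r p q 0) phi p (rmult (psi q) x).

Definition Lambda x : V :=
  \sum_(p < r.+1) \sum_(q < r.+1 | Gamma r p q 0)
    (psi p (lmult (psi q) x) - psi p (rmult (psi q) x)).

End Classes.

Section Differentials.
Variables (mu : mult_op V) (R : braid_op V).
Implicit Types (psi : mult_op V) (phi : braid_op V) (x : V \ox V \ox V).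

Definition deltaYB phi x : V \ox V \ox V :=
  lbraid R (rbraid R (lbraid phi x)) + lbraid R (rbraid phi (lbraid R x))
  + lbraid phi (rbraid R (lbraid R x)) - rbraid R (lbraid R (rbraid phi x))
  - rbraid R (lbraid phi (rbraid R x)) - rbraid phi (lbraid R (rbraid R x)).

Definition deltaH psi x : V :=
  mu (lmult psi x) + psi (lmult mu x) - mu (rmult psi x) - psi (rmult mu x).

Definition deltaYI phi psi x : V \ox V :=
  rmult psi (lbraid R (rbraid R x)) + rmult mu (lbraid phi (rbraid R x))
  + rmult mu (lbraid R (rbraid phi x)) - R (lmult psi x) - phi (lmult mu x).

Definition deltaIY phi psi x : V \ox V :=
  lmult psi (rbraid R (lbraid R x)) + lmult mu (rbraid phi (lbraid R x))
  + lmult mu (rbraid R (lbraid phi x)) - R (rmult psi x) - phi (rmult mu x).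

End Differentials.
End Obstruction.

(* Main.v *)
Require Import Defs.
From HB Require Import structures.
From mathcomp Require Import all_boot all_algebra.
From mathcomp Require Import ssrAC zify.
Import GRing.Theory.
Local Open Scope ring_scope.

(** Write K = k[[h]]/(h^m) and, for a k-module A, let bc A be its base change
to K.  An element of bc A is determined by its m coefficients in A ([hcoefE]),
so a K-linear map out of bc A given as a finite sum of maps h^e (X (x) 1)
amounts to its m coefficients in Hom(A, B): two such sums agree if and only if,
for every r < m, the sums of the X with e = r agree ([hseries_eqP]).

The braided algebra axioms for (mu_n, R_n) are equations between maps on
bc V (x)_K bc V (x)_K bc V.  The canonical isomorphism [bc_tens3] of this module
with bc (V (x) V (x) V) turns mu_n (x) 1, 1 (x) mu_n, R_n (x) 1 and 1 (x) R_n
into the series with coefficients psi_i (x) 1, and so on.  Composing series adds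
exponents ([hseries_comp]), so each axiom says that, in every degree r <= n, the
sums over i + j + l = r (or p + q = r) of the two sides agree.  This condition
[braided_coef r] does not depend on the truncation order; the axioms at order
n + 1 are therefore those at order n together with the condition in degree n + 1
([braided_seriesP]).

In degree r > 0 the terms in which one index equals r, and hence the others
vanish, are exactly those of the differentials applied to phi_r and psi_r; the
others are indexed by Gamma_r and make up Theta, Xi, Omega and Lambda.  So
[braided_coef r] is the system of the four obstruction equations
([braided_coefP]).

Two points remain for (mu_(n+1), R_(n+1)) to be a deformation.  The operator
R_(n+1) is invertible, being the composite of the base change of R with a
perturbation of the identity by a multiple of the nilpotent h
([braid_series_bij]); and it reduces to R_n because reduction modulo h^(n+1)
commutes with base change and kills the last term of the series
([mult_series_congr], [braid_series_congr]). *)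

(** * Linear maps out of tensor products *)

Section TensorExtensionality.
Set Implicit Arguments.
Unset Strict Implicit.

Lemma additive_tens_ext (K : comPzRingType) (A B : lmodType K) (Z : zmodType)
    (f g : {additive A \ox B -> Z}) :
  (forall x y, f (x \ot y) = g (x \ot y)) -> forall t, f t = g t.
Proof.
move=> fg; elim/tens_ind=> [|x y t IH]; first by rewrite !raddf0.
by rewrite !raddfD /= fg IH.
Qed.

Lemma pure0l (K : comPzRingType) (A B : lmodType K) (y : B) :
  (0 : A) \ot y = 0.
Proof. by rewrite -(scale0r (0 : A)) pureZl scale0r. Qed.

Lemma pure0r (K : comPzRingType) (A B : lmodType K) (x : A) :
  x \ot (0 : B) = 0.
Proof. by rewrite -(scale0r (0 : B)) pureZr scale0r. Qed.

Lemma tmap_lin_seriesl (K : comPzRingType) (A A' B B' : lmodType K) (a : K) n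
    (f : nat -> {linear A -> A'}) (g : {linear B -> B'}) t :
  tmap (lin_series a n f) g t = \sum_(i < n.+1) a ^+ i *: tmap (f i) g t.
Proof.
elim/tens_ind: t => [|x y t IH].
  by rewrite raddf0 big1 // => i _; rewrite raddf0 scaler0.
under eq_bigr => i _ do rewrite raddfD scalerDr.
rewrite raddfD /= IH big_split /=; congr (_ + _).
rewrite tmap_pure.
rewrite (big_morph (fun u => u \ot g y) (fun u v => pureDl u v _) (pure0l _ _)).
by apply: eq_bigr => i _; rewrite tmap_pure pureZl.
Qed.

Lemma tmap_lin_seriesr (K : comPzRingType) (A A' B B' : lmodType K) (a : K) n
    (f : {linear A -> A'}) (g : nat -> {linear B -> B'}) t :
  tmap f (lin_series a n g) t = \sum_(i < n.+1) a ^+ i *: tmap f (g i) t.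
Proof.
elim/tens_ind: t => [|x y t IH].
  by rewrite raddf0 big1 // => i _; rewrite raddf0 scaler0.
under eq_bigr => i _ do rewrite raddfD scalerDr.
rewrite raddfD /= IH big_split /=; congr (_ + _).
rewrite tmap_pure (big_morph (fun u => f x \ot u) (pureDr _) (pure0r _ _)).
by apply: eq_bigr => i _; rewrite tmap_pure pureZr.
Qed.

Lemma bc_pureE (k : comPzRingType) m (A : lmodType k) (x : A) c :
  bc_pure x c = c *: bc_pure x (1 : tseries k m).
Proof. by rewrite -bc_pureZ mulr1. Qed.

Lemma bc_ext (k : comPzRingType) m (A : lmodType k) (M : lmodType (tseries k m))
    (f g : {linear bc m A -> M}) :
  (forall x, f (bc_pure x 1) = g (bc_pure x 1)) -> forall t, f t = g t.
Proof.
move=> fg; elim/bc_ind=> [|x c t IH]; first by rewrite !raddf0.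
by rewrite !raddfD /= IH bc_pureE !linearZ /= fg.
Qed.

(** Over k[[h]]/(h^m), the tensors of elements x (x) 1 span
    bc A (x) bc B, although as an abelian group it also involves the scalars. *)
Lemma bc2_ext (k : comPzRingType) m (A B : lmodType k) (M : lmodType (tseries k m))
    (f g : {linear bc m A \ox bc m B -> M}) :
  (forall x y, f (bc_pure x 1 \ot bc_pure y 1) = g (bc_pure x 1 \ot bc_pure y 1)) ->
  forall t, f t = g t.
Proof.
move=> fg; apply: additive_tens_ext => s t.
have pl u : linear (fun s : bc m A => s \ot (u : bc m B)).
  by move=> a v w; rewrite pureDl pureZl.
have pr u : linear (fun t : bc m B => (u : bc m A) \ot t).
  by move=> a v w; rewrite pureDr pureZr.
elim/bc_ind: s => [|x c s IH].
  by rewrite pure0l !raddf0.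
rewrite pureDl !raddfD /= IH; congr (_ + _).
elim/bc_ind: t {IH} => [|y d t IH].
  by rewrite pure0r !raddf0.
rewrite pureDr !raddfD /= IH (bc_pureE x) (bc_pureE y) pureZl pureZr.
by rewrite !linearZ /= fg.
Qed.

Lemma bc3_ext (k : comPzRingType) m (A B C : lmodType k) (M : lmodType (tseries k m))
    (f g : {linear bc m A \ox bc m B \ox bc m C -> M}) :
  (forall x y z, f (bc_pure x 1 \ot bc_pure y 1 \ot bc_pure z 1) =
                 g (bc_pure x 1 \ot bc_pure y 1 \ot bc_pure z 1)) ->
  forall t, f t = g t.
Proof.
move=> fg; apply: additive_tens_ext => s t.
elim/bc_ind: t => [|z d t IH].
  by rewrite pure0r !raddf0.
rewrite pureDr !raddfD /= IH (bc_pureE z) pureZr !linearZ /=.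
congr (_ *: _ + _); move: s {IH}.
have pl : linear (fun s : bc m A \ox bc m B => s \ot (bc_pure z 1 : bc m C)).
  by move=> a v w; rewrite pureDl pureZl.
pose h : {linear _ -> _} :=
  HB.pack (fun s : bc m A \ox bc m B => s \ot (bc_pure z 1 : bc m C))
    (GRing.isLinear.Build _ _ _ _ _ pl).
exact: (@bc2_ext _ _ _ _ _ (f \o h) (g \o h) (fun x y => fg x y z)).
Qed.

End TensorExtensionality.

(** * Series of maps and their coefficients *)

Section FormalSeries.
Set Implicit Arguments.
Unset Strict Implicit.
Variables (k : comPzRingType) (m : nat).

(** The index type and the exponents are arbitrary so that the composite of two
    series is again one, indexed by pairs; for the same reason powers beyond the
    truncation order may occur. *)
Definition hseries (A B : lmodType k) (I : finType) (e : I -> nat)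
    (X : I -> {linear A -> B}) (y : bc m A) : bc m B :=
  \sum_(i : I) hbar k m ^+ e i *: bc_map (X i) y.

Definition ord_hseries (A B : lmodType k) n (X : nat -> {linear A -> B}) :
    bc m A -> bc m B :=
  hseries (@nat_of_ord n.+1) (fun i : 'I_n.+1 => X i).

Lemma hseries_comp (A B C : lmodType k) (I J : finType) (d : I -> nat) (e : J -> nat)
    (X : I -> {linear B -> C}) (Y : J -> {linear A -> B}) y :
  hseries d X (hseries e Y y) =
  hseries (fun p : I * J => d p.1 + e p.2)%N (fun p => X p.1 \o Y p.2) y.
Proof.
rewrite /hseries.
rewrite -(pair_bigA _ (fun i j => hbar k m ^+ (d i + e j) *: bc_map (X i \o Y j) y)) /=.
apply: eq_bigr => i _; rewrite (raddf_sum (bc_map (X i))) scaler_sumr; apply: eq_bigr => j _.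
rewrite /= linearZ /= scalerA -exprD; congr (_ *: _).
elim/bc_ind: y => [|x c t IH]; first by rewrite !raddf0.
by rewrite !raddfD /= IH !bc_map_pure.
Qed.

Section Coefficient.
Variables (A : lmodType k) (r : 'I_m).

Definition hcoef : bc m A -> A := tens_lift (fun (x : A) (c : tseries k m) => c r *: x).

Fact hcoef_bilinear : bilinear_fun (fun (x : A) (c : tseries k m) => c r *: x).
Proof.
split=> [c|x] a u v; first by rewrite scalerDr !scalerA mulrC.
by rewrite !ffunE scalerDl scalerA.
Qed.

Lemma hcoef_pure x c : hcoef (bc_pure x c) = c r *: x.
Proof. exact/tens_lift_pure/bilinear_balanced/hcoef_bilinear. Qed.

Lemma hcoefD s t : hcoef (s + t) = hcoef s + hcoef t.
Proof. exact/tens_liftD/bilinear_balanced/hcoef_bilinear. Qed.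

Lemma hcoef0 : hcoef 0 = 0.
Proof. by apply: (addrI (hcoef 0)); rewrite -hcoefD !addr0. Qed.

End Coefficient.

Lemma hbarXE e (i : 'I_m) : (hbar k m ^+ e) i = (i == e :> nat)%:R.
Proof.
elim: e i => [|e IH] i; first by rewrite expr0 ffunE.
rewrite exprS ffunE.
under eq_bigr => a _.
  under eq_bigr => b _ do rewrite IH ffunE.
  over.
case: (i =P e.+1 :> nat) => [ie|ie].
  have lt1 : (1 < m)%N by have := ltn_ord i; lia.
  have lte : (e < m)%N by have := ltn_ord i; lia.
  rewrite (bigD1 (Ordinal lt1)) //= [X in _ + X]big1 ?addr0 => [|a a1].
    rewrite (bigD1 (Ordinal lte)) /= ?ie ?add1n //.
    rewrite eqxx mulr1 big1 ?addr0 // => b /andP[/eqP b1].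
    by rewrite -val_eqE /= => /negPf ->; rewrite mulr0.
  apply: big1 => b _; move: a1; rewrite -val_eqE /= => /negPf ->.
  by rewrite mul0r.
apply: big1 => a _; apply: big1 => b /eqP abi.
by case: eqP => a1; case: eqP => b1; rewrite ?mul0r ?mulr0 //; exfalso; lia.
Qed.

Lemma hbarX_trunc e : (m <= e)%N -> hbar k m ^+ e = 0.
Proof.
move=> me; apply/ffunP=> i; rewrite hbarXE [RHS]ffunE.
by case: eqP => // ie; have := ltn_ord i; lia.
Qed.

Lemma bc_pure_sum (A : lmodType k) (x : A) (I : finType) (P : pred I) c :
  bc_pure x (\sum_(i | P i) c i : tseries k m) = \sum_(i | P i) bc_pure x (c i).
Proof. by rewrite (big_morph (bc_pure x) (bc_pureD x) (pure0r _ _)). Qed.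

(** Every c in k[[h]]/(h^m) is a combination of the powers h^r with r < m, so
    x (x) c is the sum of the h^r (c_r x (x) 1). *)
Lemma hcoefE (A : lmodType k) (s : bc m A) :
  s = \sum_(r < m) hbar k m ^+ r *: bc_pure (hcoef r s) 1.
Proof.
elim/bc_ind: s => [|x c s IH].
  by rewrite big1 // => r _; rewrite hcoef0 /bc_pure pure0l scaler0.
under eq_bigr => r _ do rewrite hcoefD bc_pureDl scalerDr hcoef_pure.
rewrite big_split /= -IH; congr (_ + _).
under eq_bigr => r _ do rewrite -bc_pureZ mulr1 /bc_pure pureZl -pureZr.
rewrite -(bc_pure_sum x predT); congr bc_pure; apply/ffunP=> i.
rewrite sum_ffunE (bigD1 i) //= big1 ?addr0 => [|j /negPf ji].
  by rewrite ffunE hbarXE eqxx; apply/esym/mulr1.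
by rewrite ffunE hbarXE eq_sym val_eqE ji; apply: mulr0.
Qed.

Section Compare.
Variables (A B : lmodType k) (I : finType) (e : I -> nat) (X : I -> {linear A -> B}).

Lemma hcoef_hseries (r : 'I_m) x :
  hcoef r (hseries e X (bc_pure x 1)) = \sum_(i | e i == r) X i x.
Proof.
rewrite /hseries (big_morph _ (hcoefD r) (hcoef0 _ r)) [RHS]big_mkcond.
apply: eq_bigr => i _; rewrite bc_map_pure -bc_pureZ mulr1 hcoef_pure hbarXE eq_sym.
by case: eqP; rewrite ?scale1r ?scale0r.
Qed.

Lemma hseriesD s t : hseries e X (s + t) = hseries e X s + hseries e X t.
Proof.
rewrite /hseries -big_split; apply: eq_bigr => i _.
by rewrite raddfD scalerDr.
Qed.

Lemma hseriesZ c s : hseries e X (c *: s) = c *: hseries e X s.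
Proof.
rewrite /hseries scaler_sumr; apply: eq_bigr => i _.
by rewrite linearZ /= !scalerA mulrC.
Qed.

Lemma hseries_linear : linear (hseries e X).
Proof. by move=> c s t; rewrite hseriesD hseriesZ. Qed.

HB.instance Definition _ := GRing.isLinear.Build (tseries k m) _ _ _
  (hseries e X) hseries_linear.

End Compare.

(** A K-linear map out of bc A is determined by its values on the elements
    x (x) 1, and those values by their coefficients. *)
Lemma hseries_eqP (A B : lmodType k) (I J : finType) (d : I -> nat) (e : J -> nat)
    (X : I -> {linear A -> B}) (Y : J -> {linear A -> B}) :
  hseries d X =1 hseries e Y <->
  (forall r, (r < m)%N -> forall x,
    \sum_(i | d i == r) X i x = \sum_(j | e j == r) Y j x).
Proof.
split=> [XY r rm x|XY].
  by rewrite -(hcoef_hseries _ _ (Ordinal rm)) XY hcoef_hseries.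
apply: bc_ext => x; rewrite [LHS]hcoefE [RHS]hcoefE.
by apply: eq_bigr => r _; rewrite !hcoef_hseries XY.
Qed.
End FormalSeries.
HB.instance Definition _ k m A B n X := GRing.Linear.on (@ord_hseries k m A B n X).

(** * Operations on triple tensor powers as series *)

Section Intertwine.
Set Implicit Arguments.
Unset Strict Implicit.
Variables (k : comPzRingType).

Definition bc_tens3 m (A B C : lmodType k) :
    bc m A \ox bc m B \ox bc m C -> bc m (A \ox B \ox C) :=
  @bc_tens k m (A \ox B) C \o tmap (@bc_tens k m A B) idfun.
HB.instance Definition _ m A B C := GRing.Linear.on (@bc_tens3 m A B C).

Definition bc_tens3V m (A B C : lmodType k) :
    bc m (A \ox B \ox C) -> bc m A \ox bc m B \ox bc m C :=
  tmap (@bc_tensV k m A B) idfun \o @bc_tensV k m (A \ox B) C.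

Lemma bc_tens3_pure m (A B C : lmodType k) (x : A) (y : B) (z : C) :
  @bc_tens3 m A B C (bc_pure x 1 \ot bc_pure y 1 \ot bc_pure z 1) =
  bc_pure (x \ot y \ot z) 1.
Proof. by rewrite /bc_tens3 /= tmap_pure /= !bc_tens_pure !mulr1. Qed.

Lemma bc_tens3K m (A B C : lmodType k) :
  cancel (@bc_tens3 m A B C) (@bc_tens3V m A B C).
Proof.
move=> t; rewrite /bc_tens3 /bc_tens3V /= bc_tensK.
elim/tens_ind: t => [|s z t IH]; first by rewrite !raddf0.
by rewrite !raddfD /= IH !tmap_pure /= bc_tensK.
Qed.

Lemma bc_tens3VK m (A B C : lmodType k) :
  cancel (@bc_tens3V m A B C) (@bc_tens3 m A B C).
Proof.
move=> t; rewrite /bc_tens3 /bc_tens3V /= -[RHS]bc_tensVK; congr bc_tens.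
elim/tens_ind: (bc_tensV t) => [|s z u IH]; first by rewrite !raddf0.
by rewrite !raddfD /= IH !tmap_pure /= bc_tensVK.
Qed.

Variable V : lmodType k.
Variables (n : nat) (psi : nat -> mult_op V) (phi : nat -> braid_op V).
Notation T3 := (@bc_tens3 n.+1 V V V).

Lemma mult_seriesE x :
  mult_series n psi x = ord_hseries n psi (bc_tens x).
Proof. by []. Qed.

Lemma braid_seriesE x :
  bc_tens (braid_series n phi x) = ord_hseries n phi (bc_tens x).
Proof.
rewrite /= /lin_series raddf_sum; apply: eq_bigr => i _.
by rewrite /= linearZ /= bc_tensVK.
Qed.

Lemma lmult_series x :
  bc_tens (lmult (mult_series n psi) x) = ord_hseries n (fun i => lmult (psi i)) (T3 x).
Proof.
move: x; apply: (bc3_ext (f := @bc_tens k n.+1 V V \o lmult (mult_series n psi))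
  (g := ord_hseries n (fun i => lmult (psi i)) \o T3)) => x y z /=.
rewrite bc_tens3_pure tmap_lin_seriesl raddf_sum; apply: eq_bigr => i _.
by rewrite /= linearZ /= tmap_pure /= bc_tens_pure !bc_map_pure bc_tens_pure !mulr1 /= tmap_pure.
Qed.

Lemma rmult_series x :
  bc_tens (rmult (mult_series n psi) x) = ord_hseries n (fun i => rmult (psi i)) (T3 x).
Proof.
move: x; apply: (bc3_ext (f := @bc_tens k n.+1 V V \o rmult (mult_series n psi))
  (g := ord_hseries n (fun i => rmult (psi i)) \o T3)) => x y z /=.
rewrite bc_tens3_pure tassoc_pure tmap_lin_seriesr raddf_sum; apply: eq_bigr => i _.
rewrite /= linearZ /= tmap_pure /= bc_tens_pure !bc_map_pure bc_tens_pure !mulr1 /=.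
by rewrite tassoc_pure tmap_pure.
Qed.

Lemma bc_tens3_tensVl m (t : V \ox V) (z : V) :
  @bc_tens3 m V V V (bc_tensV (bc_pure t 1) \ot bc_pure z 1) = bc_pure (t \ot z) 1.
Proof. by rewrite /bc_tens3 /= tmap_pure /= bc_tensVK bc_tens_pure mulr1. Qed.

(** Extension of scalars of an operator on V (x) V passes through [bc_tensV],
    whose value must be followed through the associator; the tensor t, being the
    value of that operator, need not be pure. *)
Lemma bc_tens3_tensVr m (x : V) (t : V \ox V) :
  @bc_tens3 m V V V (tassocV (bc_pure x 1 \ot bc_tensV (bc_pure t 1))) =
  bc_pure (tassocV (x \ot t)) 1.
Proof.
rewrite bc_tensV_pure scale1r; elim/tens_ind: t => [|y z t IH].
  by rewrite bc_tensV_fun0 !pure0r !raddf0 /bc_pure pure0l.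
rewrite bc_tensV_funD !pureDr !raddfD /= bc_pureDl -IH; congr (_ + _).
by rewrite bc_tensV_fun_pure !tassocV_pure [LHS]bc_tens3_pure.
Qed.

Lemma lbraid_series x :
  T3 (lbraid (braid_series n phi) x) = ord_hseries n (fun i => lbraid (phi i)) (T3 x).
Proof.
move: x; apply: (bc3_ext (f := T3 \o lbraid (braid_series n phi))
  (g := ord_hseries n (fun i => lbraid (phi i)) \o T3)) => x y z.
rewrite [LHS]/= [RHS]/= bc_tens3_pure tmap_lin_seriesl raddf_sum; apply: eq_bigr => i _.
rewrite /= linearZ; congr (_ *: _).
by rewrite tmap_pure /= bc_tens_pure !bc_map_pure mulr1 [LHS]bc_tens3_tensVl /= tmap_pure.
Qed.

Lemma rbraid_series x :
  T3 (rbraid (braid_series n phi) x) = ord_hseries n (fun i => rbraid (phi i)) (T3 x).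
Proof.
move: x; apply: (bc3_ext (f := T3 \o rbraid (braid_series n phi))
  (g := ord_hseries n (fun i => rbraid (phi i)) \o T3)) => x y z.
rewrite [LHS]/= [RHS]/= bc_tens3_pure tassoc_pure tmap_lin_seriesr.
rewrite (raddf_sum (@tassocV _ _ _ _)) raddf_sum.
apply: eq_bigr => i _; rewrite /= linearZ /= linearZ; congr (_ *: _).
rewrite [tmap _ _ _]tmap_pure /= bc_tens_pure !bc_map_pure mulr1 [LHS]bc_tens3_tensVr /=.
by rewrite tassoc_pure tmap_pure.
Qed.

End Intertwine.

(** * Invertibility of the deformed braiding *)

Section Unipotent.
Set Implicit Arguments.
Unset Strict Implicit.

(** The inverse of 1 + cW is the geometric series in -cW, which is finite. *)
Lemma unipotent_bij (K : comPzRingType) (M : lmodType K) (W : {linear M -> M})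
    (c : K) N :
  c ^+ N = 0 -> bijective (fun y => y + c *: W y).
Proof.
move=> cN0.
pose u z j := (- c) ^+ j *: iter j W z.
(* Both composites with the geometric series telescope to this sum. *)
have tele z : \sum_(j < N) (u z j - u z j.+1) = z.
  rewrite -(big_mkord xpredT (fun j => u z j - u z j.+1)).
  under eq_bigr => j _ do rewrite -opprB.
  rewrite sumrN telescope_sumr // /u opprB expr0 scale1r.
  by rewrite exprNn cN0 mulr0 scale0r subr0.
have uS z j : u z j.+1 = - (c *: ((- c) ^+ j *: iter j.+1 W z)).
  by rewrite /u exprS mulNr scaleNr scalerA.
exists (fun z => \sum_(j < N) u z j) => z.
  rewrite -[RHS]tele; apply: eq_bigr => j _; rewrite uS opprK /u.
  have iterE y : iter j W (z + c *: y) = iter j W z + c *: iter j W y.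
    by elim: (j : nat) => //= i ->; rewrite raddfD /= linearZ.
  by rewrite iterE -iterSr scalerDr !scalerA [_ * c]mulrC.
rewrite -[RHS]tele raddf_sum scaler_sumr -big_split /=; apply: eq_bigr => j _.
by rewrite uS opprK /u linearZ.
Qed.

Lemma bc_map_cancel (k : comPzRingType) m (A B : lmodType k) (f : {linear A -> B}) :
  bijective f ->
  exists g : {linear bc m B -> bc m A},
    cancel (bc_map f) g /\ cancel g (bc_map f).
Proof.
case=> g fK gK.
have lg : linear g by apply: can2_linear fK gK.
pose G : {linear B -> A} := HB.pack g (GRing.isLinear.Build _ _ _ _ _ lg).
exists (bc_map G); split; elim/bc_ind => [|x c t IH]; rewrite ?raddf0 //.
  by rewrite !raddfD /= IH !bc_map_pure /= fK.
by rewrite !raddfD /= IH !bc_map_pure /= gK.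
Qed.

(** With g the inverse of X_0 (x) 1, the series factors as
    (1 + h D g) (X_0 (x) 1), where h D collects the terms of positive degree. *)
Lemma ord_hseries_bij (k : comPzRingType) m (A B : lmodType k) n
    (X : nat -> {linear A -> B}) :
  bijective (X 0%N) -> bijective (@ord_hseries k m A B n X).
Proof.
move=> /(@bc_map_cancel _ m)[g [fK gK]].
pose D : {linear bc m A -> bc m B} :=
  hseries (@nat_of_ord n) (fun i : 'I_n => X i.+1).
apply: (@eq_bij _ _ ((fun y => y + hbar k m *: (D \o g) y) \o bc_map (X 0%N))).
  apply: bij_comp; last by exists g.
  exact/unipotent_bij/(hbarX_trunc _ (leqnn m)).
move=> y; rewrite /= fK /ord_hseries /hseries big_ord_recl expr0 scale1r.
congr (_ + _); rewrite scaler_sumr; apply: eq_bigr => i _.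
by rewrite scalerA -exprS.
Qed.

Lemma braid_series_bij (k : comPzRingType) (V : lmodType k) n (phi : nat -> braid_op V) :
  bijective (phi 0%N) -> bijective (braid_series n phi).
Proof.
move=> /(@ord_hseries_bij _ n.+1 _ _ n phi) bij.
apply: (@eq_bij _ _ (@bc_tensV _ _ _ _ \o ord_hseries n phi \o @bc_tens _ _ _ _)).
  apply: bij_comp; last by exists (@bc_tensV _ _ _ _); [exact: bc_tensK | exact: bc_tensVK].
  by apply: bij_comp => //; exists (@bc_tens _ _ _ _); [exact: bc_tensVK | exact: bc_tensK].
by move=> x; rewrite /= -braid_seriesE bc_tensK.
Qed.
End Unipotent.

(** * Reduction modulo a smaller power of h *)

Section Reduction.
Set Implicit Arguments.
Unset Strict Implicit.
Variables (k : comPzRingType) (m : nat).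

Lemma tseries_red_hbarX e : tseries_red (hbar k m.+1 ^+ e) = hbar k m ^+ e.
Proof. by apply/ffunP=> i; rewrite ffunE !hbarXE. Qed.

Lemma bc_red0 (A : lmodType k) : bc_red (0 : bc m.+1 A) = 0.
Proof. by apply: (addrI (bc_red 0)); rewrite -bc_redD !addr0. Qed.

Lemma bc_red_map (A B : lmodType k) (f : {linear A -> B}) (s : bc m.+1 A) :
  bc_red (bc_map f s) = bc_map f (bc_red s).
Proof.
elim/bc_ind: s => [|x c t IH]; first by rewrite !(raddf0, bc_red0).
by rewrite !(raddfD, bc_redD) /= IH !(bc_map_pure, bc_red_pure).
Qed.

Variable V : lmodType k.

Lemma bc_red2D (s t : bc m.+1 V \ox bc m.+1 V) :
  bc_red2 (s + t) = bc_red2 s + bc_red2 t.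
Proof. exact/tens_liftD/bc_red2_balanced. Qed.

Lemma bc_red20 : bc_red2 (0 : bc m.+1 V \ox bc m.+1 V) = 0.
Proof. by apply: (addrI (bc_red2 0)); rewrite -bc_red2D !addr0. Qed.

Lemma bc_red2Z c (s : bc m.+1 V \ox bc m.+1 V) :
  bc_red2 (c *: s) = tseries_red c *: bc_red2 s.
Proof.
elim/tens_ind: s => [|x y t IH]; first by rewrite scaler0 bc_red20 scaler0.
by rewrite scalerDr !bc_red2D IH -pureZl !bc_red2_pure bc_redZ pureZl scalerDr.
Qed.

Lemma bc_red_tens (s : bc m.+1 V \ox bc m.+1 V) :
  bc_red (bc_tens s) = bc_tens (bc_red2 s).
Proof.
elim/tens_ind: s => [|s t u IH]; first by rewrite bc_red20 !raddf0 bc_red0.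
rewrite raddfD bc_redD bc_red2D raddfD /= IH bc_red2_pure; congr (_ + _).
elim/bc_ind: s => [|x c s IHs].
  by rewrite bc_red0 !pure0l !raddf0 bc_red0.
rewrite bc_redD !pureDl !raddfD /= bc_redD IHs; congr (_ + _).
elim/bc_ind: t {IH IHs} => [|y d t IH].
  by rewrite bc_red0 !pure0r !raddf0 bc_red0.
rewrite bc_redD !pureDr !raddfD /= bc_redD IH; congr (_ + _).
by rewrite !bc_red_pure !bc_tens_pure bc_red_pure rmorphM.
Qed.

Lemma bc_red2_tensV (s : bc m.+1 (V \ox V)) :
  bc_red2 (bc_tensV s) = bc_tensV (bc_red s).
Proof.
by apply: (can_inj (@bc_tensK k m V V)); rewrite -bc_red_tens !bc_tensVK.
Qed.
End Reduction.

Lemma mult_series_congr (k : comPzRingType) (V : lmodType k) n (psi : nat -> mult_op V) :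
  mult_congr (mult_series n.+1 psi) (mult_series n psi).
Proof.
move=> x; rewrite /= /lin_series.
rewrite (big_morph _ (@bc_redD _ _ _) (@bc_red0 _ _ _)) big_ord_recr /=.
rewrite bc_redZ tseries_red_hbarX hbarX_trunc // scale0r addr0.
by apply: eq_bigr => i _; rewrite bc_redZ tseries_red_hbarX bc_red_map bc_red_tens.
Qed.

Lemma braid_series_congr (k : comPzRingType) (V : lmodType k) n (phi : nat -> braid_op V) :
  braid_congr (braid_series n.+1 phi) (braid_series n phi).
Proof.
move=> x; rewrite /= /lin_series.
rewrite (big_morph _ (@bc_red2D _ _ _) (@bc_red20 _ _ _)) big_ord_recr /=.
rewrite bc_red2Z tseries_red_hbarX hbarX_trunc // scale0r addr0.
apply: eq_bigr => i _; rewrite bc_red2Z tseries_red_hbarX bc_red2_tensV.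
by rewrite bc_red_map bc_red_tens.
Qed.

(** * Sums over indices of fixed total degree *)

Section Convolution.
Set Implicit Arguments.
Unset Strict Implicit.
Variable Z : nmodType.

Definition conv2 N r (F : nat -> nat -> Z) : Z :=
  \sum_(p : 'I_N * 'I_N | (p.1 + p.2 == r)%N) F p.1 p.2.

(** The indices are bracketed to the right, as [hseries_comp] produces them. *)
Definition conv3 N r (F : nat -> nat -> nat -> Z) : Z :=
  \sum_(p : 'I_N * ('I_N * 'I_N) | (p.1 + (p.2.1 + p.2.2) == r)%N)
    F p.1 p.2.1 p.2.2.

Lemma big_ord_trunc M N (G : nat -> Z) :
  (M <= N)%N -> (forall i, (M <= i)%N -> G i = 0) ->
  \sum_(i < N) G i = \sum_(i < M) G i.
Proof.
move=> MN G0; rewrite (big_ord_widen _ _ MN) big_mkcond [RHS]big_mkcond.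
by apply: eq_bigr => i _; case: ltnP => // /G0.
Qed.

(** Indices of total r are at most r.  This makes the degree r conditions at
    different truncation orders comparable. *)
Lemma conv2_widen N r F : (r < N)%N -> conv2 N r F = conv2 r.+1 r F.
Proof.
move=> rN.
have E M : conv2 M r F = \sum_(i < M) \sum_(j < M) if (i + j == r)%N then F i j else 0.
  rewrite /conv2 big_mkcond.
  by rewrite (pair_bigA _ (fun i j : 'I_M => if (i + j == r)%N then F i j else 0)).
rewrite !E.
rewrite (big_ord_trunc (G := fun i => \sum_(j < N) if (i + j == r)%N then F i j else 0) rN).
  apply: eq_bigr => i _.
  apply: (big_ord_trunc (G := fun j => if (i + j == r)%N then F i j else 0) rN) => j rj.
  by case: eqP => //; lia.
by move=> i ri; apply: big1 => j _; case: eqP => //; lia.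
Qed.

Lemma conv3_widen N r F : (r < N)%N -> conv3 N r F = conv3 r.+1 r F.
Proof.
move=> rN; pose C i j l := if (i + (j + l) == r)%N then F i j l else 0.
have E M : conv3 M r F = \sum_(i < M) \sum_(j < M) \sum_(l < M) C i j l.
  rewrite /conv3 big_mkcond.
  rewrite -(pair_bigA _ (fun (i : 'I_M) (q : 'I_M * 'I_M) => C i q.1 q.2)).
  by apply: eq_bigr => i _; rewrite -(pair_bigA _ (fun j l : 'I_M => C i j l)).
have C0 i j l : (r < i)%N || (r < j)%N || (r < l)%N -> C i j l = 0.
  by move=> h; rewrite /C; case: eqP => //; lia.
rewrite !E (big_ord_trunc (G := fun i => \sum_(j < N) \sum_(l < N) C i j l) rN).
  apply: eq_bigr => i _.
  rewrite (big_ord_trunc (G := fun j => \sum_(l < N) C i j l) rN).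
    apply: eq_bigr => j _.
    by apply: (big_ord_trunc (G := C i j) rN) => l rl; rewrite C0 // rl !orbT.
  by move=> j rj; apply: big1 => l _; rewrite C0 // rj orbT.
by move=> i ri; apply: big1 => j _; apply: big1 => l _; rewrite C0 // ri.
Qed.

(** Since r > 0, the pairs (0, r) and (r, 0) are distinct, and Gamma consists of
    the remaining pairs. *)
Lemma conv2_Gamma r F : (0 < r)%N ->
  conv2 r.+1 r F = F 0%N r + F r 0%N
    + \sum_(p < r.+1) \sum_(q < r.+1 | Gamma r p q 0) F p q.
Proof.
move=> r0; rewrite /conv2.
rewrite (bigD1 (ord0, ord_max)) /=; last by rewrite add0n.
rewrite (bigD1 (ord_max, ord0)) /=; last first.
  by rewrite xpair_eqE -!val_eqE /=; lia.
rewrite addrA; congr (_ + _); rewrite pair_big_dep /=.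
apply: eq_bigl => -[p q]; rewrite /Gamma !xpair_eqE -!val_eqE /=.
by apply/idP/idP; lia.
Qed.

Lemma conv3_Gamma r F : (0 < r)%N ->
  conv3 r.+1 r F = F 0%N 0%N r + F 0%N r 0%N + F r 0%N 0%N
    + \sum_(i < r.+1) \sum_(j < r.+1) \sum_(l < r.+1 | Gamma r i j l) F i j l.
Proof.
move=> r0; rewrite /conv3.
rewrite (bigD1 (ord0, (ord0, ord_max))) /=; last by rewrite !add0n.
rewrite (bigD1 (ord0, (ord_max, ord0))) /=; last first.
  by rewrite !xpair_eqE -!val_eqE /=; lia.
rewrite (bigD1 (ord_max, (ord0, ord0))) /=; last first.
  by rewrite !xpair_eqE -!val_eqE /=; lia.
rewrite !addrA; congr (_ + _).
under [RHS]eq_bigr => i _ do rewrite (pair_big_dep xpredT) /=.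
rewrite (pair_big_dep xpredT) /=.
apply: eq_bigl => -[i [j l]]; rewrite /Gamma !xpair_eqE -!val_eqE /=.
by apply/idP/idP; lia.
Qed.
End Convolution.

(** * The axioms degree by degree *)

Section Coefficientwise.
Set Implicit Arguments.
Unset Strict Implicit.
Variables (k : comPzRingType) (V : lmodType k).
Variables (psi : nat -> mult_op V) (phi : nat -> braid_op V).

(** The braided algebra axioms for the two series in degree r, without the
    invertibility of the braiding, which only concerns phi 0. *)
Record braided_coef r : Prop := {
  coef_assoc : forall x,
    conv2 r.+1 r (fun p q => psi p (lmult (psi q) x)) =
    conv2 r.+1 r (fun p q => psi p (rmult (psi q) x));
  coef_YB : forall x,
    conv3 r.+1 r (fun i j l => lbraid (phi i) (rbraid (phi j) (lbraid (phi l) x))) =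
    conv3 r.+1 r (fun i j l => rbraid (phi i) (lbraid (phi j) (rbraid (phi l) x)));
  coef_YI : forall x,
    conv3 r.+1 r (fun i j l => rmult (psi i) (lbraid (phi j) (rbraid (phi l) x))) =
    conv2 r.+1 r (fun p q => phi p (lmult (psi q) x));
  coef_IY : forall x,
    conv3 r.+1 r (fun i j l => lmult (psi i) (rbraid (phi j) (lbraid (phi l) x))) =
    conv2 r.+1 r (fun p q => phi p (rmult (psi q) x))
}.

Section Composites.
Variables (n : nat) (A B B' C D D' : lmodType k).

Lemma ord_hseries_eq22 (X : nat -> {linear B -> C}) (Y : nat -> {linear A -> B})
    (X' : nat -> {linear B' -> C}) (Y' : nat -> {linear A -> B'}) :
  (forall y : bc n.+1 A, ord_hseries n X (ord_hseries n Y y)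
     = ord_hseries n X' (ord_hseries n Y' y)) <->
  (forall r, (r <= n)%N -> forall x,
     conv2 r.+1 r (fun p q => X p (Y q x)) = conv2 r.+1 r (fun p q => X' p (Y' q x))).
Proof.
have E := (hseries_eqP n.+1
  (fun p : 'I_n.+1 * 'I_n.+1 => p.1 + p.2)%N (fun p : 'I_n.+1 * 'I_n.+1 => p.1 + p.2)%N
  (fun p => X p.1 \o Y p.2) (fun p => X' p.1 \o Y' p.2)).
apply: (iff_trans (iff_trans _ E)).
  by split=> h y; have := h y; rewrite /ord_hseries !hseries_comp.
by split=> h r rn x; have := h r rn x; rewrite -!(@conv2_widen _ n.+1).
Qed.

Lemma ord_hseries_eq32 (X : nat -> {linear B -> C}) (Y : nat -> {linear D -> B})
    (Z : nat -> {linear A -> D})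
    (X' : nat -> {linear B' -> C}) (Y' : nat -> {linear A -> B'}) :
  (forall y : bc n.+1 A, ord_hseries n X (ord_hseries n Y (ord_hseries n Z y))
     = ord_hseries n X' (ord_hseries n Y' y)) <->
  (forall r, (r <= n)%N -> forall x,
     conv3 r.+1 r (fun i j l => X i (Y j (Z l x))) =
     conv2 r.+1 r (fun p q => X' p (Y' q x))).
Proof.
have E := (hseries_eqP n.+1
  (fun p : 'I_n.+1 * ('I_n.+1 * 'I_n.+1) => p.1 + (p.2.1 + p.2.2))%N
  (fun p : 'I_n.+1 * 'I_n.+1 => p.1 + p.2)%N
  (fun p => X p.1 \o (Y p.2.1 \o Z p.2.2)) (fun p => X' p.1 \o Y' p.2)).
apply: (iff_trans (iff_trans _ E)).
  by split=> h y; have := h y; rewrite /ord_hseries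
    (hseries_comp _ _ (fun i : 'I_n.+1 => Y i)) !hseries_comp.
by split=> h r rn x; have := h r rn x;
  rewrite -!(@conv2_widen _ n.+1) // -!(@conv3_widen _ n.+1).
Qed.

Lemma ord_hseries_eq33 (X : nat -> {linear B -> C}) (Y : nat -> {linear D -> B})
    (Z : nat -> {linear A -> D})
    (X' : nat -> {linear B' -> C}) (Y' : nat -> {linear D' -> B'})
    (Z' : nat -> {linear A -> D'}) :
  (forall y : bc n.+1 A, ord_hseries n X (ord_hseries n Y (ord_hseries n Z y))
     = ord_hseries n X' (ord_hseries n Y' (ord_hseries n Z' y))) <->
  (forall r, (r <= n)%N -> forall x,
     conv3 r.+1 r (fun i j l => X i (Y j (Z l x))) =
     conv3 r.+1 r (fun i j l => X' i (Y' j (Z' l x)))).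
Proof.
have E := (hseries_eqP n.+1
  (fun p : 'I_n.+1 * ('I_n.+1 * 'I_n.+1) => p.1 + (p.2.1 + p.2.2))%N
  (fun p : 'I_n.+1 * ('I_n.+1 * 'I_n.+1) => p.1 + (p.2.1 + p.2.2))%N
  (fun p => X p.1 \o (Y p.2.1 \o Z p.2.2)) (fun p => X' p.1 \o (Y' p.2.1 \o Z' p.2.2))).
apply: (iff_trans (iff_trans _ E)).
  by split=> h y; have := h y; rewrite /ord_hseries
    (hseries_comp _ _ (fun i : 'I_n.+1 => Y i))
    (hseries_comp _ _ (fun i : 'I_n.+1 => Y' i)) !hseries_comp.
by split=> h r rn x; have := h r rn x; rewrite -!(@conv3_widen _ n.+1).
Qed.

End Composites.

Section Equations.
Variable n : nat.
Notation M := (mult_series n psi).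
Notation S := (braid_series n phi).
Notation T3 := (@bc_tens3 k n.+1 V V V).

Lemma all_bc_tens3 (P : bc n.+1 (V \ox V \ox V) -> Prop) :
  (forall x, P (T3 x)) <-> (forall y, P y).
Proof. by split=> h x //; rewrite -[x]bc_tens3VK. Qed.

Lemma assoc_seriesP :
  (forall x, M (lmult M x) = M (rmult M x)) <->
  (forall r, (r <= n)%N -> forall x,
    conv2 r.+1 r (fun p q => psi p (lmult (psi q) x)) =
    conv2 r.+1 r (fun p q => psi p (rmult (psi q) x))).
Proof.
rewrite -ord_hseries_eq22 -all_bc_tens3.
by split=> h x; have := h x; rewrite !mult_seriesE !lmult_series !rmult_series.
Qed.

Lemma YB_seriesP :
  (forall x, lbraid S (rbraid S (lbraid S x)) = rbraid S (lbraid S (rbraid S x))) <->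
  (forall r, (r <= n)%N -> forall x,
    conv3 r.+1 r (fun i j l => lbraid (phi i) (rbraid (phi j) (lbraid (phi l) x))) =
    conv3 r.+1 r (fun i j l => rbraid (phi i) (lbraid (phi j) (rbraid (phi l) x)))).
Proof.
have L x : T3 (lbraid S (rbraid S (lbraid S x))) = ord_hseries n (fun i => lbraid (phi i))
    (ord_hseries n (fun i => rbraid (phi i)) (ord_hseries n (fun i => lbraid (phi i)) (T3 x))).
  by rewrite lbraid_series rbraid_series lbraid_series.
have L' x : T3 (rbraid S (lbraid S (rbraid S x))) = ord_hseries n (fun i => rbraid (phi i))
    (ord_hseries n (fun i => lbraid (phi i)) (ord_hseries n (fun i => rbraid (phi i)) (T3 x))).
  by rewrite rbraid_series lbraid_series rbraid_series.
rewrite -ord_hseries_eq33 -all_bc_tens3.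
split=> h x; first by rewrite -L h L'.
have e := etrans (L x) (etrans (h x) (esym (L' x))).
exact: (can_inj (@bc_tens3K k n.+1 V V V) e).
Qed.

Lemma YI_seriesP :
  (forall x, rmult M (lbraid S (rbraid S x)) = S (lmult M x)) <->
  (forall r, (r <= n)%N -> forall x,
    conv3 r.+1 r (fun i j l => rmult (psi i) (lbraid (phi j) (rbraid (phi l) x))) =
    conv2 r.+1 r (fun p q => phi p (lmult (psi q) x))).
Proof.
have L x : bc_tens (rmult M (lbraid S (rbraid S x))) =
    ord_hseries n (fun i => rmult (psi i)) (ord_hseries n (fun i => lbraid (phi i))
      (ord_hseries n (fun i => rbraid (phi i)) (T3 x))).
  by rewrite rmult_series lbraid_series rbraid_series.
have L' x : bc_tens (S (lmult M x)) =
    ord_hseries n phi (ord_hseries n (fun i => lmult (psi i)) (T3 x)).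
  by rewrite braid_seriesE lmult_series.
rewrite -ord_hseries_eq32 -all_bc_tens3; split=> h x.
  exact: etrans (esym (L x)) (etrans (congr1 (@bc_tens _ _ _ _) (h x)) (L' x)).
have e := etrans (L x) (etrans (h x) (esym (L' x))).
exact: (can_inj (@bc_tensK k n.+1 V V) e).
Qed.

Lemma IY_seriesP :
  (forall x, lmult M (rbraid S (lbraid S x)) = S (rmult M x)) <->
  (forall r, (r <= n)%N -> forall x,
    conv3 r.+1 r (fun i j l => lmult (psi i) (rbraid (phi j) (lbraid (phi l) x))) =
    conv2 r.+1 r (fun p q => phi p (rmult (psi q) x))).
Proof.
have L x : bc_tens (lmult M (rbraid S (lbraid S x))) =
    ord_hseries n (fun i => lmult (psi i)) (ord_hseries n (fun i => rbraid (phi i))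
      (ord_hseries n (fun i => lbraid (phi i)) (T3 x))).
  by rewrite lmult_series rbraid_series lbraid_series.
have L' x : bc_tens (S (rmult M x)) =
    ord_hseries n phi (ord_hseries n (fun i => rmult (psi i)) (T3 x)).
  by rewrite braid_seriesE rmult_series.
rewrite -ord_hseries_eq32 -all_bc_tens3; split=> h x.
  exact: etrans (esym (L x)) (etrans (congr1 (@bc_tens _ _ _ _) (h x)) (L' x)).
have e := etrans (L x) (etrans (h x) (esym (L' x))).
exact: (can_inj (@bc_tensK k n.+1 V V) e).
Qed.

Lemma braided_seriesP :
  bijective (phi 0%N) ->
  braided_algebra M S <-> forall r, (r <= n)%N -> braided_coef r.
Proof.
move=> bij; split=> [[hA [_ hYB] hYI hIY] r rn|h].
  exact: Build_braided_coef (assoc_seriesP.1 hA r rn) (YB_seriesP.1 hYB r rn)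
    (YI_seriesP.1 hYI r rn) (IY_seriesP.1 hIY r rn).
have hA := assoc_seriesP.2 (fun r rn => coef_assoc (h r rn)).
have hYB := YB_seriesP.2 (fun r rn => coef_YB (h r rn)).
have hYI := YI_seriesP.2 (fun r rn => coef_YI (h r rn)).
have hIY := IY_seriesP.2 (fun r rn => coef_IY (h r rn)).
exact: (Build_braided_algebra hA (conj (braid_series_bij n bij) hYB) hYI hIY).
Qed.

End Equations.

(** The terms of total degree r with an index equal to r form the differentials;
    those indexed by Gamma form the obstruction classes. *)
Lemma braided_coefP (mu : mult_op V) (R : braid_op V) (r : nat) :
  psi 0%N = mu -> phi 0%N = R -> (0 < r)%N ->
  braided_coef r <->
  [/\ forall x, deltaYB R (phi r) x + Theta phi r x = 0,
      forall x, deltaYI mu R (phi r) (psi r) x + XiYI psi phi r x - OmegaYI psi phi r x = 0,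
      forall x, deltaIY mu R (phi r) (psi r) x + XiIY psi phi r x - OmegaIY psi phi r x = 0
    & forall x, deltaH mu (psi r) x + Lambda psi r x = 0].
Proof.
move=> psi0 phi0 r0.
have iffE (T : Type) (Z : zmodType) (f g h : T -> Z) :
  (forall x, h x = f x - g x) -> (forall x, f x = g x) <-> (forall x, h x = 0).
  move=> hE; split=> e x; first by rewrite hE e subrr.
  by apply/eqP; rewrite -subr_eq0 -hE e.
have EH := iffE _ _ (fun x => conv2 r.+1 r (fun p q => psi p (lmult (psi q) x)))
  (fun x => conv2 r.+1 r (fun p q => psi p (rmult (psi q) x)))
  (fun x => deltaH mu (psi r) x + Lambda psi r x).
have EYB := iffE _ _
  (fun x => conv3 r.+1 r (fun i j l => lbraid (phi i) (rbraid (phi j) (lbraid (phi l) x))))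
  (fun x => conv3 r.+1 r (fun i j l => rbraid (phi i) (lbraid (phi j) (rbraid (phi l) x))))
  (fun x => deltaYB R (phi r) x + Theta phi r x).
have EYI := iffE _ _
  (fun x => conv3 r.+1 r (fun i j l => rmult (psi i) (lbraid (phi j) (rbraid (phi l) x))))
  (fun x => conv2 r.+1 r (fun p q => phi p (lmult (psi q) x)))
  (fun x => deltaYI mu R (phi r) (psi r) x + XiYI psi phi r x - OmegaYI psi phi r x).
have EIY := iffE _ _
  (fun x => conv3 r.+1 r (fun i j l => lmult (psi i) (rbraid (phi j) (lbraid (phi l) x))))
  (fun x => conv2 r.+1 r (fun p q => phi p (rmult (psi q) x)))
  (fun x => deltaIY mu R (phi r) (psi r) x + XiIY psi phi r x - OmegaIY psi phi r x).
suff [/EH eH /EYB eYB /EYI eYI /EIY eIY] : [/\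
    forall x, deltaH mu (psi r) x + Lambda psi r x
      = conv2 r.+1 r (fun p q => psi p (lmult (psi q) x))
        - conv2 r.+1 r (fun p q => psi p (rmult (psi q) x)),
    forall x, deltaYB R (phi r) x + Theta phi r x
      = conv3 r.+1 r (fun i j l => lbraid (phi i) (rbraid (phi j) (lbraid (phi l) x)))
        - conv3 r.+1 r (fun i j l => rbraid (phi i) (lbraid (phi j) (rbraid (phi l) x))),
    forall x, deltaYI mu R (phi r) (psi r) x + XiYI psi phi r x - OmegaYI psi phi r x
      = conv3 r.+1 r (fun i j l => rmult (psi i) (lbraid (phi j) (rbraid (phi l) x)))
        - conv2 r.+1 r (fun p q => phi p (lmult (psi q) x))
  & forall x, deltaIY mu R (phi r) (psi r) x + XiIY psi phi r x - OmegaIY psi phi r x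
      = conv3 r.+1 r (fun i j l => lmult (psi i) (rbraid (phi j) (lbraid (phi l) x)))
        - conv2 r.+1 r (fun p q => phi p (rmult (psi q) x))].
  split=> [[/eH aH /eYB aYB /eYI aYI /eIY aIY]|[/eYB aYB /eYI aYI /eIY aIY /eH aH]].
    by split.
  by split.
split=> x; rewrite ?conv2_Gamma ?conv3_Gamma // ?psi0 ?phi0.
- rewrite /deltaH /Lambda.
  under eq_bigr => p _ do rewrite sumrB.
  by rewrite sumrB !opprD !addrA [LHS](ACl (1*2*5*3*4*6)%AC).
- rewrite /deltaYB /Theta.
  under eq_bigr => i _ do under eq_bigr => j _ do rewrite sumrB.
  under eq_bigr => i _ do rewrite sumrB.
  by rewrite sumrB !opprD !addrA [LHS](ACl (1*2*3*7*4*5*6*8)%AC).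
- by rewrite !opprD !addrA [LHS](ACl (3*2*1*6*4*5*7)%AC).
- by rewrite !opprD !addrA [LHS](ACl (3*2*1*6*4*5*7)%AC).
Qed.
End Coefficientwise.

(** * The extension criterion *)

Lemma is_deformation_braided {k : comPzRingType} {V : lmodType k}
    {mu : mult_op V} {R : braid_op V} {n}
    {M : mult_op (bc n.+1 V)} {S : braid_op (bc n.+1 V)} :
  is_deformation mu R M S -> braided_algebra M S.
Proof. by case. Qed.

Theorem theorem6p5 (k : comPzRingType) (V : lmodType k)
    (mu : mult_op V) (R : braid_op V) (n : nat)
    (psi : nat -> mult_op V) (phi : nat -> braid_op V) :
  braided_algebra mu R ->
  (1 <= n)%N ->
  psi 0%N = mu -> phi 0%N = R ->
  is_deformation mu R (mult_series n psi) (braid_series n phi) ->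
  is_deformation mu R (mult_series n.+1 psi) (braid_series n.+1 phi) <->
  [/\ forall x, deltaYB R (phi n.+1) x + Theta phi n.+1 x = 0,
      forall x, deltaYI mu R (phi n.+1) (psi n.+1) x
                + XiYI psi phi n.+1 x - OmegaYI psi phi n.+1 x = 0,
      forall x, deltaIY mu R (phi n.+1) (psi n.+1) x
                + XiIY psi phi n.+1 x - OmegaIY psi phi n.+1 x = 0
    & forall x, deltaH mu (psi n.+1) x + Lambda psi n.+1 x = 0].
Proof.
move=> [_ [bijR _] _ _] _ psi0 phi0 def_n.
rewrite -(braided_coefP psi0 phi0 (ltn0Sn n)).
have bij : bijective (phi 0%N) by rewrite phi0.
split=> [/is_deformation_braided/(braided_seriesP _ _ bij)|top]; first exact.
apply: (deformation_S def_n); last first.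
- exact: braid_series_congr.
- exact: mult_series_congr.
apply/(braided_seriesP _ _ bij) => r; rewrite leq_eqVlt => /predU1P[-> //|rn].
(* Degrees r <= n are covered by the deformation of degree n. *)
exact: ((braided_seriesP psi n bij).1 (is_deformation_braided def_n) r rn).
Qed.
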